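(* Let $\boldsymbol{\lambda}=(\lambda_1,\lambda_2,\lambda_3)^{\top}$ and $\boldsymbol{\lambda}'=(\lambda_1',\lambda_2',\lambda_3')^{\top}$ be real vectors, and let $\Upsilon,\Upsilon'$ be the linear maps on $2\times 2$ complex matrices given by $$\Upsilon[X]=\tfrac12 \mathrm{tr}[X]\,I+\tfrac12\sum_{i=1}^3\lambda_i\,\mathrm{tr}[\sigma_iX]\,\sigma_i,\qquad \Upsilon'[X]=\tfrac12 \mathrm{tr}[X]\,I+\tfrac12\sum_{i=1}^3\lambda_i'\,\mathrm{tr}[\sigma_iX]\,\sigma_i .$$ Suppose $\Upsilon$ and $\Upsilon'$ are positive maps. Then the map $\Upsilon\otimes\Upsilon'$ is positive and entanglement annihilating if and only if $|\lambda_i|\leqslant 1$ and $|\lambda_i'|\leqslant 1$ for $i=1,2,3$, and $\boldsymbol{\lambda}^{\top}P\boldsymbol{\lambda}'\leqslant 1$ for all $3\times3$ signed permutation matrices $P$.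
   Context: $\sigma_1,\sigma_2,\sigma_3$ are the Pauli matrices and $I$ is the $2\times2$ identity. A density operator is a positive-semidefinite operator of unit trace. A two-qubit density operator (on $\mathbb{C}^2\otimes\mathbb{C}^2$) is separable if it lies in the closure of the set of operators of the form $\sum_k p_k\,\varrho_k^A\otimes\varrho_k^B$ with $p_k\geqslant0$, $\sum_kp_k=1$ and $\varrho_k^A,\varrho_k^B$ qubit density operators; otherwise it is entangled. A linear map is positive if it maps positive-semidefinite operators to positive-semidefinite operators. A map $\Upsilon\otimes\Upsilon'$ on two-qubit operators is entanglement annihilating if its output on every two-qubit density operator is separable. A signed permutation matrix is a matrix with exactly one nonzero entry in each row and column, each nonzero entry being $\pm1$. *)

(* Defs.v *)
From HB Require Import structures.
From mathcomp Require Import all_boot all_order all_algebra.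
From mathcomp Require Import complex mxtens.
From mathcomp Require Import all_classical all_reals all_analysis.

Set Implicit Arguments.
Unset Strict Implicit.
Unset Printing Implicit Defensive.

Import Order.TTheory GRing.Theory Num.Theory.
Import numFieldNormedType.Exports.

Local Open Scope classical_set_scope.
Local Open Scope ring_scope.
Local Open Scope complex_scope.
Local Open Scope sesquilinear_scope.

(* MathComp-Analysis puts the modulus topology on every numFieldType K through
   K^o, but it is not inferred on the carrier R[i]; it is copied here, and
   'M[R[i]]_n then gets the entrywise (norm) topology. *)
HB.instance Definition _ (R : realType) :=
  NormedModule.copy R[i] (R[i] : numFieldType)^o.

Section Operators.
Variable R : realType.
Local Notation C := R[i].

(* 0 <= z in C entails that z is real; hence psd matrices are Hermitian. *)
Definition psd n (A : 'M[C]_n) : Prop :=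
  forall v : 'cV[C]_n, 0 <= (v ^t* *m A *m v) 0 0.

Definition density n (rho : 'M[C]_n) : Prop := psd rho /\ \tr rho = 1.

Definition positive_map m n (f : {linear 'M[C]_m -> 'M[C]_n}) : Prop :=
  forall X : 'M[C]_m, psd X -> psd (f X).

Definition product_mixtures : set 'M[C]_(2 * 2) :=
  [set rho | exists (n : nat) (p : 'I_n -> R) (rhoA rhoB : 'I_n -> 'M[C]_2),
     [/\ forall k, 0 <= p k, \sum_k p k = 1,
         forall k, density (rhoA k), forall k, density (rhoB k)
       & rho = \sum_k (p k)%:C *: tensmx (rhoA k) (rhoB k)]].

Definition separable (rho : 'M[C]_(2 * 2)) : Prop :=
  density rho /\ closure product_mixtures rho.

(* The tensor product of two linear maps, obtained by expanding its argument in
   the basis E_ij (x) E_kl; see tensor_map_tens for the defining property. *)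
Definition tensor_map m n p q (f : {linear 'M[C]_m -> 'M[C]_p})
    (g : {linear 'M[C]_n -> 'M[C]_q}) (Z : 'M[C]_(m * n)) : 'M[C]_(p * q) :=
  \sum_(i < m) \sum_(j < m) \sum_(k < n) \sum_(l < n)
    Z (mxtens_index (i, k)) (mxtens_index (j, l)) *:
      tensmx (f (delta_mx i j)) (g (delta_mx k l)).

Lemma tensor_map_is_linear m n p q (f : {linear 'M[C]_m -> 'M[C]_p})
  (g : {linear 'M[C]_n -> 'M[C]_q}) : linear (tensor_map f g).
Proof.
move=> a X Y; rewrite /tensor_map scaler_sumr -big_split; apply: eq_bigr => i _.
rewrite scaler_sumr -big_split; apply: eq_bigr => j _.
rewrite scaler_sumr -big_split; apply: eq_bigr => k _.
rewrite scaler_sumr -big_split; apply: eq_bigr => l _.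
by rewrite !mxE scalerDl scalerA.
Qed.

HB.instance Definition _ m n p q (f : {linear 'M[C]_m -> 'M[C]_p})
    (g : {linear 'M[C]_n -> 'M[C]_q}) :=
  GRing.isLinear.Build C 'M[C]_(m * n) 'M[C]_(p * q) _ (tensor_map f g)
    (tensor_map_is_linear f g).

Lemma tensor_map_tens m n p q (f : {linear 'M[C]_m -> 'M[C]_p})
    (g : {linear 'M[C]_n -> 'M[C]_q}) (A : 'M[C]_m) (B : 'M[C]_n) :
  tensor_map f g (tensmx A B) = tensmx (f A) (g B).
Proof.
rewrite [in f A](matrix_sum_delta A) [in g B](matrix_sum_delta B).
rewrite !linear_sum; apply/matrixP => u v; rewrite mxE !summxE big_distrl /=.
apply: eq_bigr => i _; rewrite linear_sum !summxE big_distrl /=.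
apply: eq_bigr => j _; rewrite summxE big_distrr /=.
apply: eq_bigr => k _; rewrite linear_sum !summxE big_distrr /=.
apply: eq_bigr => l _; rewrite !linearZ !tensmxE !mxE.
by rewrite mulrACA.
Qed.

Definition entanglement_annihilating
    (F : {linear 'M[C]_(2 * 2) -> 'M[C]_(2 * 2)}) : Prop :=
  forall rho : 'M[C]_(2 * 2), density rho -> separable (F rho).

Definition mx2 (a b c d : C) : 'M[C]_2 :=
  \matrix_(i, j) (nth [::] [:: [:: a; b]; [:: c; d]] i)`_j.

(* sigma 0, sigma 1, sigma 2 are the Pauli matrices sigma_1, sigma_2, sigma_3. *)
Definition sigma (i : 'I_3) : 'M[C]_2 :=
  [:: mx2 0 1 1 0; mx2 0 (- 'i) 'i 0; mx2 1 0 0 (- 1)]`_i.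

Definition pauli_map (lam : 'cV[R]_3) (X : 'M[C]_2) : 'M[C]_2 :=
  (2^-1 * \tr X) *: 1%:M +
  2^-1 *: \sum_(i < 3) ((lam i 0)%:C * \tr (sigma i *m X)) *: sigma i.

Lemma pauli_map_is_linear (lam : 'cV[R]_3) : linear (pauli_map lam).
Proof.
move=> a X Y; rewrite /pauli_map scalerDr addrACA !scalerA; congr (_ + _).
  by rewrite linearP /= mulrDr scalerDl mulrCA.
rewrite mulrC -scalerA -scalerDr; congr (_ *: _).
rewrite scaler_sumr -big_split; apply: eq_bigr => i _ /=.
by rewrite mulmxDr -scalemxAr linearP /= mulrDr scalerDl scalerA mulrCA.
Qed.

HB.instance Definition _ (lam : 'cV[R]_3) :=
  GRing.isLinear.Build C 'M[C]_2 'M[C]_2 _ (pauli_map lam)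
    (pauli_map_is_linear lam).

Definition signed_perm_mx n (P : 'M[R]_n) : Prop :=
  [/\ forall i, exists! j, P i j != 0,
      forall j, exists! i, P i j != 0
    & forall i j, P i j != 0 -> P i j = 1 \/ P i j = - 1].

End Operators.

(* Main.v *)
(* Replace the two maps by the homogeneous maps
   l : X |-> l0 tr(X) I + sum_i l_i tr(sigma_i X) sigma_i, and let K(l, m) say that
   l (x) m sends psd matrices into the convex cone generated by the products A (x) B
   of psd matrices.  K is stable under sums and nonnegative multiples in each
   argument, under exchange of l and m, and under signed permutations of
   (l1, l2, l3) and of (m1, m2, m3).

   Sufficiency.  A linear programming argument shows that every pair allowed by
   the inequalities is generated, through these stabilities, by four families
   with 0 <= y <= 1:
     (1; 1, 1, 1) (x) (1; 1, 0, 0),       (1; 1, y, 0) (x) (1 + y; 1, 1, 1),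
     (1; 1, y, y) (x) (1 + y; 1, 1, 0),   (1; 1, 1, y) (x) (2 + y; 1, 1, 1).
   The first one measures and prepares.  For the others it is enough to treat
   rank-one inputs, and the output is then a sum of a manifestly separable matrix
   and of a psd block matrix [[A, B], [B, D]] with equal off-diagonal blocks,
   which is always separable.

   Necessity.  A linear functional that is nonnegative on products stays
   nonnegative on the closure of the mixtures.  Evaluating tr(Y) - <v, Y v>, v
   being maximally entangled, on the image of the maximally entangled state gives
   l1 m1 + l2 m2 + l3 m3 <= l0 m0, and signed permutations of l give the rest. *)

Require Import Defs.
From HB Require Import structures.
From mathcomp Require Import all_boot all_order all_algebra.
From mathcomp Require Import complex mxtens ring lra.
From mathcomp Require Import all_classical all_reals all_analysis.

Set Implicit Arguments.
Unset Strict Implicit.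
Unset Printing Implicit Defensive.

Import Order.TTheory GRing.Theory Num.Theory.
Import numFieldNormedType.Exports.

Local Open Scope ring_scope.
Local Open Scope complex_scope.
Local Open Scope sesquilinear_scope.

(** For l and m nonnegative and decreasing, the permutation inequalities reduce to l1 m1 + l2 m2 +
    l3 m3 <= l0 m0 (rearrangement). With l fixed, this and m1 <= m0 are two linear bounds on the
    layer coordinates m1 - m2, m2 - m3, m3, so m is a combination of the layers (1, 0, 0), (1, 1,
    0), (1, 1, 1), each with the least m0 allowed, and of vectors with m0 = m1. Exchanging l and m
    and repeating this leaves a layer against an l with l0 = l1. The constants 1 + y and 2 + y are
    the values of m0 that make the inequality an equality there. Equal off-diagonal blocks mean that
    the first factor has l2 = 0, hence the permutations of axes before the block criterion is
    applied. No permutation achieves this for (1; 1, 1, y) (x) (2 + y; 1, 1, 1) with y > 0; there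
    the difference of the off-diagonal blocks is split off, and a Hermitian multiple of it has a
    scalar square, which makes that part separable. The symmetries act by a congruence on the input
    and a positive map on the output, so they hold for the cone itself in one direction and for its
    dual description in the other. *)

(** * Generators of a polyhedral cone cut out by two linear bounds *)

Section Layers.
Variable R : realFieldType.

Variable Q : R -> R -> R -> R -> Prop.
Hypothesis QD : forall a b c d a' b' c' d',
  Q a b c d -> Q a' b' c' d' -> Q (a + a') (b + b') (c + c') (d + d').
Hypothesis QZ : forall t a b c d, 0 <= t -> Q a b c d ->
  Q (t * a) (t * b) (t * c) (t * d).
Hypothesis Q0 : Q 1 0 0 0.

(* A fraction 1 - t of the parts with slope g_k > 1 is left to their own generators, with
   t chosen such that the remainder satisfies l = a + b + c. *)
Lemma layer_hull (g1 g2 g3 : R) :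
  (forall a b c, 0 <= a -> 0 <= b -> 0 <= c ->
     g1 * a + g2 * b + g3 * c <= a + b + c -> Q (a + b + c) a b c) ->
  (1 <= g1 -> Q g1 1 0 0) -> (1 <= g2 -> Q g2 0 1 0) -> (1 <= g3 -> Q g3 0 0 1) ->
  forall l a b c, 0 <= a -> 0 <= b -> 0 <= c ->
    a + b + c <= l -> g1 * a + g2 * b + g3 * c <= l -> Q l a b c.
Proof.
move=> Hv H1 H2 H3 l a b c a0 b0 c0 hl hg.
have Qeq p q r s p' q' r' s' : Q p q r s -> p = p' -> q = q' -> r = r' -> s = s' ->
  Q p' q' r' s' by move=> + <- <- <- <-.
have Qslack p p' q r s : Q p q r s -> p <= p' -> Q p' q r s.
  move=> h hp; have := QD h (QZ (t := p' - p) _ Q0).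
  by rewrite subr_ge0 => /(_ hp) h'; apply: (Qeq _ _ _ _ _ _ _ _ h'); ring.
(* A coordinate is kept whole: it goes to [xl] when its slope is at most 1 and otherwise to [xh],
   where its own generator is available. *)
have split (g x : R) : 0 <= x -> exists xl xh, [/\ 0 <= xl, 0 <= xh, x = xl + xh,
    g * xl <= xl & (xh = 0 \/ 1 <= g)].
  move=> x0; case: (leP g 1) => hg1.
    exists x, 0; split; rewrite ?addr0 //; last by left.
    by rewrite ler_piMl.
  exists 0, x; split; rewrite ?add0r ?mulr0 //; right; exact: ltW.
have [a1 [a2 [a10 a20 ea la ha]]] := split g1 a a0.
have [b1 [b2 [b10 b20 eb lb hb]]] := split g2 b b0.
have [c1 [c2 [c10 c20 ec lc hc]]] := split g3 c c0.
have QA t : 0 <= t -> Q (t * a2 * g1) (t * a2) 0 0.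
  move=> t0; case: ha => [->|h].
    by apply: (Qeq _ _ _ _ _ _ _ _ (QZ (lexx 0) Q0)); ring.
  by apply: (Qeq _ _ _ _ _ _ _ _ (QZ (t := t * a2) _ (H1 h))); rewrite ?mulr_ge0 //; ring.
have QB t : 0 <= t -> Q (t * b2 * g2) 0 (t * b2) 0.
  move=> t0; case: hb => [->|h].
    by apply: (Qeq _ _ _ _ _ _ _ _ (QZ (lexx 0) Q0)); ring.
  by apply: (Qeq _ _ _ _ _ _ _ _ (QZ (t := t * b2) _ (H2 h))); rewrite ?mulr_ge0 //; ring.
have QC t : 0 <= t -> Q (t * c2 * g3) 0 0 (t * c2).
  move=> t0; case: hc => [->|h].
    by apply: (Qeq _ _ _ _ _ _ _ _ (QZ (lexx 0) Q0)); ring.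
  by apply: (Qeq _ _ _ _ _ _ _ _ (QZ (t := t * c2) _ (H3 h))); rewrite ?mulr_ge0 //; ring.
set H := a2 * g1 + b2 * g2 + c2 * g3.
have key t : 0 <= t -> t <= 1 ->
    a1 + b1 + c1 + t * (a2 + b2 + c2) <= l - (1 - t) * H ->
    (a1 + b1 + c1 + t * (a2 + b2 + c2) = l - (1 - t) * H \/ t = 0) -> Q l a b c.
  move=> t0 t1 hle heq.
  have t1' : 0 <= 1 - t by rewrite subr_ge0.
  have hv : Q (a1 + t * a2 + (b1 + t * b2) + (c1 + t * c2))
              (a1 + t * a2) (b1 + t * b2) (c1 + t * c2).
    apply: Hv; rewrite ?addr_ge0 ?mulr_ge0 //.
    case: heq => [heq|t00]; last by rewrite t00 !mul0r !addr0; lra.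
    by rewrite /H ea eb ec in hle heq hg *; lra.
  have hsum := QD (QD (QD hv (QA _ t1')) (QB _ t1')) (QC _ t1').
  have := Qslack _ l _ _ _ hsum; rewrite /H in hle => h.
  by apply: (Qeq _ _ _ _ _ _ _ _ (h _)); rewrite ?ea ?eb ?ec; [lra|ring..].
have [h0|h0] := leP (a1 + b1 + c1) (l - H).
  by apply: (key 0); rewrite ?lexx ?ler01 ?mul0r ?addr0 ?subr0 ?mul1r //; right.
have H1' : a1 + b1 + c1 + (a2 + b2 + c2) <= l by lra.
set den := H - (a2 + b2 + c2).
have den0 : 0 < den by rewrite /den; lra.
pose t := (a1 + b1 + c1 + H - l) / den.
have tE : t * den = a1 + b1 + c1 + H - l by rewrite /t divfK // gt_eqF.
have teq : a1 + b1 + c1 + t * (a2 + b2 + c2) = l - (1 - t) * H.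
  by rewrite /den in tE; lra.
apply: (key t); last by left.
- by rewrite divr_ge0 ?ltW //; lra.
- by rewrite ler_pdivrMr // /den; lra.
- by rewrite teq.
Qed.
End Layers.

(** * Linear programming: reduction of the admissible pairs to the four families *)

Section PauliCone.
Variables (R : realFieldType) (K : R -> R -> R -> R -> R -> R -> R -> R -> Prop).

Hypothesis Ksym : forall l0 l1 l2 l3 m0 m1 m2 m3,
  K l0 l1 l2 l3 m0 m1 m2 m3 -> K m0 m1 m2 m3 l0 l1 l2 l3.
Hypothesis KD : forall l0 l1 l2 l3 k0 k1 k2 k3 m0 m1 m2 m3,
  K l0 l1 l2 l3 m0 m1 m2 m3 -> K k0 k1 k2 k3 m0 m1 m2 m3 ->
  K (l0 + k0) (l1 + k1) (l2 + k2) (l3 + k3) m0 m1 m2 m3.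
Hypothesis KZ : forall c l0 l1 l2 l3 m0 m1 m2 m3, 0 <= c ->
  K l0 l1 l2 l3 m0 m1 m2 m3 -> K (c * l0) (c * l1) (c * l2) (c * l3) m0 m1 m2 m3.
Hypothesis K12 : forall l0 l1 l2 l3 m0 m1 m2 m3,
  K l0 l1 l2 l3 m0 m1 m2 m3 -> K l0 l2 l1 l3 m0 m1 m2 m3.
Hypothesis K13 : forall l0 l1 l2 l3 m0 m1 m2 m3,
  K l0 l1 l2 l3 m0 m1 m2 m3 -> K l0 l3 l2 l1 m0 m1 m2 m3.
Hypothesis KN2 : forall l0 l1 l2 l3 m0 m1 m2 m3,
  K l0 l1 l2 l3 m0 m1 m2 m3 -> K l0 l1 (- l2) l3 m0 m1 m2 m3.
Hypothesis K_111_100 : K 1 1 1 1 1 1 0 0.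
Hypothesis K_1y0_111 : forall y, 0 <= y <= 1 -> K 1 1 y 0 (1 + y) 1 1 1.
Hypothesis K_1yy_110 : forall y, 0 <= y <= 1 -> K 1 1 y y (1 + y) 1 1 0.
Hypothesis K_11y_111 : forall y, 0 <= y <= 1 -> K 1 1 1 y (2 + y) 1 1 1.

Let Keq l0 l1 l2 l3 m0 m1 m2 m3 k0 k1 k2 k3 n0 n1 n2 n3 :
  K l0 l1 l2 l3 m0 m1 m2 m3 -> l0 = k0 -> l1 = k1 -> l2 = k2 -> l3 = k3 ->
  m0 = n0 -> m1 = n1 -> m2 = n2 -> m3 = n3 -> K k0 k1 k2 k3 n0 n1 n2 n3.
Proof. by move=> + <- <- <- <- <- <- <- <-. Qed.

(** Averaging with the reflection [KN2] moves a coordinate anywhere between its value and its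
    opposite, so the coordinates of l can be lowered one at a time. *)
Let Kle l0 l1 l2 l3 m0 m1 m2 m3 k1 k2 k3 :
  K l0 l1 l2 l3 m0 m1 m2 m3 -> 0 <= k1 <= l1 -> 0 <= k2 <= l2 -> 0 <= k3 <= l3 ->
  K l0 k1 k2 k3 m0 m1 m2 m3.
Proof.
have shrink2 a0 a1 a2 a3 k : K a0 a1 a2 a3 m0 m1 m2 m3 -> 0 <= k <= a2 ->
    K a0 a1 k a3 m0 m1 m2 m3.
  move=> h /andP[k0 ka]; have [a20|a20] := leP a2 0.
    by have -> : k = a2 by lra.
  have aN : a2 != 0 by rewrite gt_eqF.
  have t0 : 0 <= (a2 + k) / (2 * a2) by rewrite divr_ge0 //; lra.
  have t1 : 0 <= (a2 - k) / (2 * a2) by rewrite divr_ge0 //; lra.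
  by apply: (Keq (KD (KZ t0 h) (KZ t1 (KN2 h)))) => //; field.
move=> h h1 h2 h3; apply/K12/(shrink2 _ _ l1) => //; apply/K12.
apply/K12/K13/K12/(shrink2 _ _ l3) => //; apply/K12/K13/K12.
exact: (shrink2 _ _ l2).
Qed.

(** This is the slack direction: [Kslack] adds multiples of it to raise l0 alone. *)
Let Kz m0 m1 m2 m3 : 0 <= m0 -> 0 <= m1 <= m0 -> 0 <= m2 <= m0 -> 0 <= m3 <= m0 ->
  K 1 0 0 0 m0 m1 m2 m3.
Proof.
move=> m00 h1 h2 h3; apply: (@Kle 1 1 0 0); rewrite ?lexx ?ler01 //.
apply: Ksym; apply: (@Kle m0 m0 m0 m0) => //.
by apply: (Keq (KZ m00 K_111_100)); rewrite ?mulr1.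
Qed.

Let K_100 l0 l1 l2 l3 : 0 <= l1 <= l0 -> 0 <= l2 <= l0 -> 0 <= l3 <= l0 ->
  K l0 l1 l2 l3 1 1 0 0.
Proof.
move=> h1 h2 h3; have l00 : 0 <= l0 by lra.
apply: (@Kle l0 l0 l0 l0) => //.
by apply: (Keq (KZ l00 K_111_100)); rewrite ?mulr1.
Qed.

Let Kslack l0 l1 l2 l3 m0 m1 m2 m3 k0 : 0 <= m0 -> 0 <= m1 <= m0 -> 0 <= m2 <= m0 ->
  0 <= m3 <= m0 -> K l0 l1 l2 l3 m0 m1 m2 m3 -> l0 <= k0 -> K k0 l1 l2 l3 m0 m1 m2 m3.
Proof.
move=> m00 h1 h2 h3 h hk; have hk' : 0 <= k0 - l0 by rewrite subr_ge0.
by apply: (Keq (KD h (KZ hk' (Kz m00 h1 h2 h3)))); ring.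
Qed.

Let K_110 l1 l2 l3 : 0 <= l3 <= l2 -> l2 <= l1 -> K l1 l1 l2 l3 (l1 + l2) l1 l1 0.
Proof.
move=> /andP[l30 l32] l21.
have [l10|l10] := leP l1 0.
  have [-> -> ->] : [/\ l1 = 0, l2 = 0 & l3 = 0] by split; lra.
  by apply: (Keq (KZ (lexx 0) (Ksym (KZ (lexx 0) K_111_100)))); ring.
have y1 : 0 <= l2 / l1 <= 1 by rewrite divr_ge0 ?ler_pdivrMr //; lra.
have l10' := ltW l10; have lN : l1 != 0 by rewrite gt_eqF.
have h := Ksym (KZ l10' (K_1yy_110 y1)).
have {}h : K (1 + l2 / l1) 1 1 0 l1 l1 l2 l3.
  apply/Ksym/(@Kle l1 l1 l2 l2); rewrite ?lexx ?l10' //; try lra.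
  by apply: (Keq (Ksym h)) => //; field.
by apply/Ksym/(Keq (KZ l10' h)) => //; field.
Qed.

(** Since m is symmetric, l2 and l3 may be exchanged, so it suffices that (l2, l3) is a mean of an
    extreme point with the same sum and of its mirror image. The extreme point is (l2 + l3, 0) while
    l2 + l3 <= l1 and (l1, l2 + l3 - l1) beyond, which are the families [K_1y0_111] and
    [K_11y_111]. *)
Let K_111 l1 l2 l3 : 0 <= l3 <= l2 -> l2 <= l1 ->
  K l1 l1 l2 l3 (l1 + l2 + l3) l1 l1 l1.
Proof.
move=> /andP[l30 l32] l21.
have [l10|l10] := leP l1 0.
  have [-> -> ->] : [/\ l1 = 0, l2 = 0 & l3 = 0] by split; lra.
  by apply: (Keq (KZ (lexx 0) (Ksym (KZ (lexx 0) K_111_100)))); ring.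
have l10' := ltW l10; have lN : l1 != 0 by rewrite gt_eqF.
have low s : 0 <= s <= l1 -> K l1 l1 s 0 (l1 + s) l1 l1 l1.
  move=> hs; have y1 : 0 <= s / l1 <= 1 by rewrite divr_ge0 ?ler_pdivrMr //; lra.
  have h := KZ l10' (Ksym (KZ l10' (K_1y0_111 y1))).
  by apply: (Keq (Ksym h)) => //; field.
have high s : 0 <= s <= l1 -> K l1 l1 l1 s (2 * l1 + s) l1 l1 l1.
  move=> hs; have y1 : 0 <= s / l1 <= 1 by rewrite divr_ge0 ?ler_pdivrMr //; lra.
  have h := KZ l10' (Ksym (KZ l10' (K_11y_111 y1))).
  by apply: (Keq (Ksym h)) => //; field.
have sw23 a b c d : K a b c d (l1 + l2 + l3) l1 l1 l1 ->
  K a b d c (l1 + l2 + l3) l1 l1 l1 by move/K12/K13/K12.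
have mix a b s t : K l1 l1 a b (l1 + l2 + l3) l1 l1 l1 -> 0 <= t <= 1 ->
    a + b = l2 + l3 -> s = t * a + (1 - t) * b -> l2 = s ->
    K l1 l1 l2 l3 (l1 + l2 + l3) l1 l1 l1.
  move=> h ht hab hs e; have t0 : 0 <= t by lra.
  have t1 : 0 <= 1 - t by lra.
  apply: (Keq (KD (KZ t0 h) (KZ t1 (sw23 _ _ _ _ h)))) => //; try ring.
  - by rewrite e hs.
  - by have := hab; rewrite e hs; lra.
have [h|h] := leP (l2 + l3) l1.
  have hl := low (l2 + l3) _; have [s0|s0] := leP (l2 + l3) 0.
    by apply: (Keq (low 0 _)) => //; lra.
  apply: (mix (l2 + l3) 0 _ (l2 / (l2 + l3))) => //.
  - by apply: (Keq (hl _)) => //; lra.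
  - by rewrite divr_ge0 ?ler_pdivrMr //; lra.
  - by rewrite addr0.
  - by field; rewrite gt_eqF.
set s := l2 + l3 - l1.
have [s0|s0] := leP l1 s.
  by apply: (Keq (high l1 _)) => //; rewrite /s in s0; lra.
apply: (mix l1 s _ ((l2 - s) / (l1 - s))) => //.
- by apply: (Keq (high s _)) => //; rewrite /s in s0 *; lra.
- by rewrite divr_ge0 ?ler_pdivrMr //; rewrite /s in s0 *; lra.
- by rewrite /s; ring.
- by field; rewrite subr_eq0 gt_eqF.
Qed.

(** The layers of m have weights m1 - m2, m2 - m3, m3 and, up to the factor 1 / l1, costs l1, l1 +
    l2, l1 + l2 + l3. Summation by parts gives the total l1 m1 + l2 m2 + l3 m3; what remains of m0
    is slack. *)
Let K_edge l1 l2 l3 m0 m1 m2 m3 : 0 <= l3 <= l2 -> l2 <= l1 ->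
  0 <= m3 <= m2 -> m2 <= m1 -> m1 <= m0 ->
  l1 * m1 + l2 * m2 + l3 * m3 <= l1 * m0 -> K l1 l1 l2 l3 m0 m1 m2 m3.
Proof.
move=> /andP[l30 l32] l21 /andP[m30 m32] m21 m10 hB.
have [l10|l10] := leP l1 0.
  have [-> -> ->] : [/\ l1 = 0, l2 = 0 & l3 = 0] by split; lra.
  apply: (Keq (KZ (lexx 0) (@Kz m0 m1 m2 m3 _ _ _ _))); rewrite ?mul0r //; lra.
have l10' := ltW l10; have lN : l1 != 0 by rewrite gt_eqF.
have h1 : K l1 l1 l2 l3 1 1 0 0 by apply: K_100; lra.
have h2 : K l1 l1 l2 l3 (l1 + l2) l1 l1 0 by apply: K_110; lra.
have h3 : K l1 l1 l2 l3 (l1 + l2 + l3) l1 l1 l1 by apply: K_111; lra.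
have c1 : 0 <= m1 - m2 by lra.
have c2 : 0 <= (m2 - m3) / l1 by rewrite divr_ge0 //; lra.
have c3 : 0 <= m3 / l1 by rewrite divr_ge0.
have h : K ((l1 * m1 + l2 * m2 + l3 * m3) / l1) m1 m2 m3 l1 l1 l2 l3.
  by apply: (Keq (KD (KD (KZ c1 (Ksym h1)) (KZ c2 (Ksym h2))) (KZ c3 (Ksym h3)))) => //; field.
by apply/Ksym/(Kslack _ _ _ _ h); rewrite ?ler_pdivrMr //; lra.
Qed.

(** Mean of the edge case l = (t; t, 2 - t, 0) and of its image under the exchange of the first two
    axes, which fixes m. The bound is attained: t + (2 - t) = t (2 / t). *)
Let K_110_avg t : 1 <= t <= 2 -> K t 1 1 0 (2 / t) 1 1 1.
Proof.
move=> ht; have tN : t != 0 by rewrite gt_eqF //; lra.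
have t0 : 0 < t by lra.
have h : K t t (2 - t) 0 (2 / t) 1 1 1.
  by apply: K_edge; rewrite ?ler_pdivlMr //; [lra..|rewrite mulrCA mulfV //; lra].
have hh : 0 <= 1 / 2 :> R by lra.
by apply: (Keq (KD (KZ hh h) (KZ hh (K12 h)))) => //; field.
Qed.

(** Mean of (t; t, (3 - t) / 2, (3 - t) / 2) over the three positions of t; 1 <= t makes this l
    decreasing and t <= 3 keeps it nonnegative. *)
Let K_111_avg t : 1 <= t <= 3 -> K t 1 1 1 (3 / t) 1 1 1.
Proof.
move=> ht; have tN : t != 0 by rewrite gt_eqF //; lra.
have t0 : 0 < t by lra.
have h : K t t ((3 - t) / 2) ((3 - t) / 2) (3 / t) 1 1 1.
  by apply: K_edge; rewrite ?ler_pdivlMr //; [lra..|rewrite mulrCA mulfV //; lra].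
have hh : 0 <= 1 / 3 :> R by lra.
by apply: (Keq (KD (KD (KZ hh h) (KZ hh (K12 h))) (KZ hh (K13 h)))) => //; field.
Qed.

(** [layer_hull] with a = m1 - m2, b = m2 - m3, c = m3, where m1 <= m0 reads a + b + c <= m0. The
    slopes [g1], [g2], [g3] are the values of m0 charged to the three layers, and the hypothesis on
    a, b, c is the face m0 = m1. *)
Let K_layered t l1 l2 l3 :
  1 <= t -> 0 <= l1 <= t -> 0 <= l2 <= t -> 0 <= l3 <= t ->
  forall g1 g2 g3,
  (forall a b c, 0 <= a -> 0 <= b -> 0 <= c ->
     g1 * a + g2 * b + g3 * c <= a + b + c ->
     K t l1 l2 l3 (a + b + c) (a + b + c) (b + c) c) ->
  (1 <= g1 -> K t l1 l2 l3 g1 1 0 0) -> (1 <= g2 -> K t l1 l2 l3 g2 1 1 0) ->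
  (1 <= g3 -> K t l1 l2 l3 g3 1 1 1) ->
  forall m0 m1 m2 m3, 0 <= m3 <= m2 -> m2 <= m1 -> m1 <= m0 ->
    g1 * (m1 - m2) + g2 * (m2 - m3) + g3 * m3 <= m0 -> K t l1 l2 l3 m0 m1 m2 m3.
Proof.
move=> t1 h1 h2 h3 g1 g2 g3 Hv H1 H2 H3 m0 m1 m2 m3 hm3 hm2 hm1 hg.
pose Q d a b c := K t l1 l2 l3 d (a + b + c) (b + c) c.
have hQ : Q m0 (m1 - m2) (m2 - m3) m3.
  apply: (@layer_hull R Q _ _ _ g1 g2 g3); rewrite /Q; try lra.
  - move=> a b c d a' b' c' d' h h'.
    by apply/Ksym; apply: (Keq (KD (Ksym h) (Ksym h'))) => //; ring.
  - move=> s a b c d s0 h.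
    by apply/Ksym; apply: (Keq (KZ s0 (Ksym h))) => //; ring.
  - by apply/Ksym; apply: (Keq (@Kz t l1 l2 l3 _ _ _ _)); rewrite ?addr0 //; lra.
  - exact: Hv.
  - by move=> /H1 h; apply: (Keq h); rewrite ?addr0 ?add0r.
  - by move=> /H2 h; apply: (Keq h); rewrite ?addr0 ?add0r.
  - by move=> /H3 h; apply: (Keq h); rewrite ?addr0 ?add0r.
by apply: (Keq hQ) => //; ring.
Qed.

(** A layer with k ones costs k / t and is a generator of its own only for k >= t. On the face m0 =
    m1 the factors are exchanged and [K_edge] applies. *)
Let K_111_gen t m0 m1 m2 m3 : 1 <= t -> 0 <= m3 <= m2 -> m2 <= m1 -> m1 <= m0 ->
  m1 + m2 + m3 <= t * m0 -> K t 1 1 1 m0 m1 m2 m3.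
Proof.
move=> t1 h3 h2 h1 hm; have t0 : 0 < t by lra.
have tN : t != 0 by rewrite gt_eqF.
apply: (@K_layered t 1 1 1 _ _ _ _ (1 / t) (2 / t) (3 / t)); rewrite ?ler01 //.
- move=> a b c a0 b0 c0; rewrite -(ler_pM2l t0).
  have -> : t * (1 / t * a + 2 / t * b + 3 / t * c) = a + 2 * b + 3 * c by field.
  by move=> h; apply: Ksym; apply: K_edge; lra.
- rewrite ler_pdivlMr // mul1r => ht; have -> : t = 1 by lra.
  by apply: (Keq K_111_100) => //; field.
- rewrite ler_pdivlMr // mul1r => ht; apply: Ksym.
  have h : K (2 / t) 1 1 0 (2 / (2 / t)) 1 1 1.
    by apply: K_110_avg; rewrite ler_pdivlMr // ler_pdivrMr //; lra.
  by apply: (Keq h) => //; field.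
- by rewrite ler_pdivlMr // mul1r => ht; apply: K_111_avg; lra.
- rewrite -(ler_pM2l t0).
  have -> : t * (1 / t * (m1 - m2) + 2 / t * (m2 - m3) + 3 / t * m3) =
    m1 + m2 + m3 by field.
  exact: hm.
Qed.

Let K_110_gen t m0 m1 m2 m3 : 1 <= t -> 0 <= m3 <= m2 -> m2 <= m1 -> m1 <= m0 ->
  m1 + m2 <= t * m0 -> K t 1 1 0 m0 m1 m2 m3.
Proof.
move=> t1 h3 h2 h1 hm; have t0 : 0 < t by lra.
have tN : t != 0 by rewrite gt_eqF.
apply: (@K_layered t 1 1 0 _ _ _ _ (1 / t) (2 / t) (2 / t)); rewrite ?ler01 ?lexx ?(ltW t0) //.
- move=> a b c a0 b0 c0; rewrite -(ler_pM2l t0).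
  have -> : t * (1 / t * a + 2 / t * b + 2 / t * c) = a + 2 * b + 2 * c by field.
  by move=> h; apply: Ksym; apply: K_edge; lra.
- rewrite ler_pdivlMr // mul1r => ht; have -> : t = 1 by lra.
  by apply: (Keq (@K_100 1 1 1 0 _ _ _)) => //; rewrite ?divr1 //; lra.
- rewrite ler_pdivlMr // mul1r => ht.
  have h : K t 1 1 0 (2 / t) 1 1 1 by apply: K_110_avg; lra.
  by apply/Ksym/(Kle (Ksym h)); lra.
- by rewrite ler_pdivlMr // mul1r => ht; apply: K_110_avg; lra.
- rewrite -(ler_pM2l t0).
  have -> : t * (1 / t * (m1 - m2) + 2 / t * (m2 - m3) + 2 / t * m3) =
    m1 + m2 by field.
  exact: hm.
Qed.

(** The layer (1, 1, 0) with m0 = l1 + l2 becomes, after exchange, (l1 + l2; 1, 1, 0) against (1;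
    l1, l2, l3), where the bound of [K_110_gen] is attained; (1, 1, 1) is treated likewise by
    [K_111_gen]. *)
Let K_sorted l1 l2 l3 m1 m2 m3 : 0 <= l3 <= l2 -> l2 <= l1 -> l1 <= 1 ->
  0 <= m3 <= m2 -> m2 <= m1 -> m1 <= 1 -> l1 * m1 + l2 * m2 + l3 * m3 <= 1 ->
  K 1 l1 l2 l3 1 m1 m2 m3.
Proof.
move=> hl3 hl2 hl1 hm3 hm2 hm1 hB.
apply: (@K_layered 1 l1 l2 l3 _ _ _ _ l1 (l1 + l2) (l1 + l2 + l3)); try lra.
- by move=> a b c a0 b0 c0 h; apply: Ksym; apply: K_edge; lra.
- by move=> h; have -> : l1 = 1 by [lra]; apply: K_100; lra.
- by move=> h; apply: Ksym; apply: K_110_gen; lra.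
- by move=> h; apply: Ksym; apply: K_111_gen; lra.
Qed.

(** Two transpositions and one reflection generate the signed permutations, which bring any triple
    to decreasing nonnegative order. *)
Let sort3 (P : R -> R -> R -> Prop) :
  (forall a b c, P a b c -> P b a c) -> (forall a b c, P a b c -> P c b a) ->
  (forall a b c, P a b c -> P a (- b) c) ->
  (forall a b c, 0 <= c -> c <= b -> b <= a -> P a b c) -> forall a b c, P a b c.
Proof.
move=> h12 h13 hN hs.
have h23 a b c : P a b c -> P a c b by move/h12/h13/h12.
have pos a b c : 0 <= a -> 0 <= b -> 0 <= c -> P a b c.
  move=> a0 b0 c0; case: (leP a b) => hab; case: (leP b c) => hbc; case: (leP a c) => hac.
  - by apply: h13; apply: hs.
  - lra.
  - by apply: h12; apply: h23; apply: hs => //; lra.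
  - by apply: h12; apply: hs => //; lra.
  - by apply: h13; apply: h23; apply: hs => //; lra.
  - by apply: h23; apply: hs => //; lra.
  - lra.
  - by apply: hs => //; lra.
have pN b a c : (forall b', 0 <= b' -> P a b' c) -> P a b c.
  move=> h; case: (leP 0 b) => [/h//|b0]; rewrite -[b]opprK; apply/hN/h; lra.
move=> a b c; apply: (pN) => b' b0; apply/h12/pN => a' a0; apply/h12/h13/h12/pN => c' c0.
by apply/h12/h13; apply: pos.
Qed.

(* The six permutations; the absolute values account for the signs. *)
Definition perm_bounds (a b c x y z : R) : Prop :=
  [/\ `|a| * `|x| + `|b| * `|y| + `|c| * `|z| <= 1,
      `|a| * `|x| + `|b| * `|z| + `|c| * `|y| <= 1
    & `|a| * `|y| + `|b| * `|x| + `|c| * `|z| <= 1] /\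
  [/\ `|a| * `|y| + `|b| * `|z| + `|c| * `|x| <= 1,
      `|a| * `|z| + `|b| * `|x| + `|c| * `|y| <= 1
    & `|a| * `|z| + `|b| * `|y| + `|c| * `|x| <= 1].

Theorem pauli_cone l1 l2 l3 m1 m2 m3 :
  [/\ `|l1| <= 1, `|l2| <= 1 & `|l3| <= 1] ->
  [/\ `|m1| <= 1, `|m2| <= 1 & `|m3| <= 1] ->
  perm_bounds l1 l2 l3 m1 m2 m3 -> K 1 l1 l2 l3 1 m1 m2 m3.
Proof.
move: l1 l2 l3; apply: sort3.
- move=> a b c h [ha hb hc] hm [[h1 h2 h3] [h4 h5 h6]].
  by apply/K12/h => //; split; split=> //; lra.
- move=> a b c h [ha hb hc] hm [[h1 h2 h3] [h4 h5 h6]].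
  by apply/K13/h => //; split; split=> //; lra.
- move=> a b c h; rewrite /perm_bounds normrN => hl hm hB.
  exact/KN2/h.
move=> l1 l2 l3 l30 l32 l21 [hl1 hl2 hl3]; move: m1 m2 m3; apply: sort3.
- move=> a b c h [ha hb hc] [[h1 h2 h3] [h4 h5 h6]].
  by apply/Ksym/K12/Ksym/h => //; split; split=> //; lra.
- move=> a b c h [ha hb hc] [[h1 h2 h3] [h4 h5 h6]].
  by apply/Ksym/K13/Ksym/h => //; split; split=> //; lra.
- move=> a b c h; rewrite /perm_bounds normrN => hm hB.
  exact/Ksym/KN2/Ksym/h.
move=> m1 m2 m3 m30 m32 m21 [hm1 hm2 hm3] [[h _ _] _].
rewrite !ger0_norm in hl1 hl2 hl3 hm1 hm2 hm3 h; try lra.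
by apply: K_sorted; lra.
Qed.

End PauliCone.

(** * Positive semidefinite matrices, tensor products and the separable cone *)

Lemma mxDE (V : nmodType) m n (A B : 'M[V]_(m, n)) i j : (A + B) i j = A i j + B i j.
Proof. by rewrite mxE. Qed.

Lemma mxZE (A : pzRingType) m n c (M : 'M[A]_(m, n)) i j : (c *: M) i j = c * M i j.
Proof. by rewrite mxE. Qed.

Section Forms.
Variable C : numClosedFieldType.

Lemma adjmxM m n p (A : 'M[C]_(m, n)) (B : 'M[C]_(n, p)) :
  (A *m B)^t* = B^t* *m A^t*.
Proof. by rewrite trmx_mul map_mxM. Qed.

Lemma adjmxK m n (A : 'M[C]_(m, n)) : A^t*^t* = A.
Proof. by apply/matrixP=> i j; rewrite !mxE conjCK. Qed.

Lemma adjmxD m n (A B : 'M[C]_(m, n)) : (A + B)^t* = A^t* + B^t*.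
Proof. by apply/matrixP=> i j; rewrite !mxE rmorphD. Qed.

Lemma adjmxZ m n c (A : 'M[C]_(m, n)) : (c *: A)^t* = c^*%R *: A^t*.
Proof. by apply/matrixP=> i j; rewrite !mxE rmorphM. Qed.

Lemma adjmxE m n (A : 'M[C]_(m, n)) i j : (A^t*) i j = (A j i)^*%R.
Proof. by rewrite !mxE. Qed.

Lemma form_trmx n (A : 'M[C]_n) (v : 'cV[C]_n) :
  (v^t* *m A^T *m v) 0 0 = ((map_mx Num.conj v)^t* *m A *m map_mx Num.conj v) 0 0.
Proof.
rewrite -[LHS]trace_mx11 -mxtrace_tr trace_mx11 !trmx_mul trmxK mulmxA.
by congr ((_ *m _ *m _) 0 0); apply/matrixP=> i j; rewrite !mxE ?conjCK.
Qed.

Lemma form_rank1 n (u v : 'cV[C]_n) : 0 <= (u^t* *m (v *m v^t*) *m u) 0 0.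
Proof.
rewrite !mulmxA -mulmxA mxE big_ord1.
have -> : (v^t* *m u) 0 0 = ((u^t* *m v) 0 0)^*%R.
  by rewrite -{1}[u]adjmxK -adjmxM adjmxE.
by rewrite mul_conjC_ge0.
Qed.

(** Polarization: the form is real at u + v and at u + 'i v, so q u v + q v u and 'i (q u v - q v u)
    are real and q v u is the conjugate of q u v. *)
Lemma form_ge0_herm n (A : 'M[C]_n) :
  (forall v : 'cV[C]_n, 0 <= (v^t* *m A *m v) 0 0) -> A^t* = A.
Proof.
move=> hA; pose q (u v : 'cV[C]_n) := (u^t* *m A *m v) 0 0.
have qr u : q u u \is Num.real by exact/ger0_real/hA.
have qD u v u' v' : q (u + v) (u' + v') = q u u' + q v u' + (q u v' + q v v').
  by rewrite /q adjmxD !mulmxDl !mulmxDr !mxDE addrACA.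
have qZr a u v : q u (a *: v) = a * q u v by rewrite /q -scalemxAr mxE.
have qZl a u v : q (a *: u) v = a^*%R * q u v.
  by rewrite /q adjmxZ -!scalemxAl mxE.
have E u v : q v u = (q u v)^*%R.
  have h1 : q u v + q v u \is Num.real.
    have -> : q u v + q v u = q (u + v) (u + v) - q u u - q v v by rewrite qD; ring.
    by rewrite !rpredB.
  have h2 : 'i * (q u v - q v u) \is Num.real.
    have -> : 'i * (q u v - q v u) = q (u + 'i *: v) (u + 'i *: v) - q u u - q v v.
      rewrite qD !qZr !qZl conjCi.
      have -> : 'i * (- 'i * q v v) = q v v by rewrite mulrA mulrN -expr2 sqrCi opprK mul1r.
      by ring.
    by rewrite !rpredB.
  move: (q u v) (q v u) h1 h2 => s t /CrealP + /CrealP.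
  rewrite rmorphD rmorphM rmorphB /= conjCi mulNr -mulrN => h1 /(mulfI (neq0Ci C)) h2.
  have : 2 * t = 2 * s^*%R.
    by have -> : 2 * t = s + t - (s - t) by [ring]; rewrite -h1 -h2; ring.
  by apply: mulfI; rewrite pnatr_eq0.
apply/matrixP=> i j; rewrite adjmxE.
have qe k l : q (delta_mx k 0) (delta_mx l 0) = A k l.
  by rewrite /q trmx_delta map_delta_mx -rowE -colE !mxE.
by rewrite -(qe i) -(qe j) -E.
Qed.

Lemma spectral_decomposition n (A : 'M[C]_n) : A^t* = A ->
  exists2 P : 'M[C]_n, P *m P^t* = 1%:M & exists2 d : 'rV[C]_n,
    P *m A *m P^t* = diag_mx d & A = P^t* *m diag_mx d *m P.
Proof.
move=> hA; have : A \is hermsymmx.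
  by apply/is_hermitianmxP; rewrite expr0 scale1r hA.
move=> /hermitian_normalmx/orthomx_spectralP.
move: (spectralmx A) (spectral_diag A) (spectral_unitarymx A) => P d PU E.
have PP := unitarymxP PU; exists P => //; rewrite invmx_unitary // in E.
exists d => //; rewrite [in LHS]E !mulmxA PP mul1mx -mulmxA.
by rewrite PP mulmx1.
Qed.

Lemma form_ge0_sum_rank1 n (A : 'M[C]_n) :
  (forall v : 'cV[C]_n, 0 <= (v^t* *m A *m v) 0 0) ->
  exists v : 'I_n -> 'cV[C]_n, A = \sum_i v i *m (v i)^t*.
Proof.
move=> hA; have [P PP [d dE AE]] := spectral_decomposition (form_ge0_herm hA).
have d_ge0 i : 0 <= d 0 i.
  have := hA (P^t* *m delta_mx i 0).
  rewrite adjmxM adjmxK -!mulmxA (mulmxA P) (mulmxA (P *m A)) dE.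
  by rewrite trmx_delta map_delta_mx mulmxA -rowE -colE !mxE eqxx mulr1n.
exists (fun i => sqrtC (d 0 i) *: (row i P)^t*).
rewrite {1}AE -mulmxA; apply/matrixP=> i j; rewrite mxE summxE.
apply: eq_bigr => k _; rewrite adjmxZ adjmxK -scalemxAl -scalemxAr scalerA.
rewrite (CrealP (ger0_real _)) ?sqrtC_ge0 // -expr2 sqrtCK mul_diag_mx !mxE.
by rewrite big_ord1 !mxE; ring.
Qed.

(** [psd] over an arbitrary [numClosedFieldType]; at [R[i]] the two are convertible. *)
Definition psdmx n (A : 'M[C]_n) : Prop :=
  forall v : 'cV[C]_n, 0 <= (v^t* *m A *m v) 0 0.

Lemma psdmx0 n : psdmx (0 : 'M[C]_n).
Proof. by move=> v; rewrite mulmx0 mul0mx mxE. Qed.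

Lemma psdmxD n (A B : 'M[C]_n) : psdmx A -> psdmx B -> psdmx (A + B).
Proof. by move=> hA hB v; rewrite mulmxDr mulmxDl mxE addr_ge0. Qed.

Lemma psdmxZ n (c : C) (A : 'M[C]_n) : 0 <= c -> psdmx A -> psdmx (c *: A).
Proof. by move=> hc hA v; rewrite -scalemxAr -scalemxAl mxE mulr_ge0. Qed.

Lemma psdmx_sum n (I : Type) (r : seq I) (P : pred I) (F : I -> 'M[C]_n) :
  (forall i, P i -> psdmx (F i)) -> psdmx (\sum_(i <- r | P i) F i).
Proof. exact: (big_ind (@psdmx n) (@psdmx0 n) (@psdmxD n)). Qed.

Lemma psdmx_congr m n (V : 'M[C]_(m, n)) (A : 'M[C]_n) :
  psdmx A -> psdmx (V *m A *m V^t*).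
Proof. by move=> hA v; have := hA (V^t* *m v); rewrite adjmxM adjmxK !mulmxA. Qed.

Lemma psdmx_rank1 n (v : 'cV[C]_n) : psdmx (v *m v^t*).
Proof. by move=> u; apply: form_rank1. Qed.

Lemma psdmx_trmx n (A : 'M[C]_n) : psdmx A -> psdmx A^T.
Proof. by move=> hA v; rewrite form_trmx; apply: hA. Qed.

Lemma psdmx_herm n (A : 'M[C]_n) : psdmx A -> A^t* = A.
Proof. exact: form_ge0_herm. Qed.

Lemma psdmx_sum_rank1 n (A : 'M[C]_n) : psdmx A ->
  exists v : 'I_n -> 'cV[C]_n, A = \sum_i v i *m (v i)^t*.
Proof. exact: form_ge0_sum_rank1. Qed.

Lemma tensmxDl m n p q (A B : 'M[C]_(m, n)) (D : 'M[C]_(p, q)) :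
  tensmx (A + B) D = tensmx A D + tensmx B D.
Proof. by apply/matrixP=> i j; rewrite !mxE mulrDl. Qed.

Lemma tensmxDr m n p q (A : 'M[C]_(m, n)) (B D : 'M[C]_(p, q)) :
  tensmx A (B + D) = tensmx A B + tensmx A D.
Proof. by apply/matrixP=> i j; rewrite !mxE mulrDr. Qed.

Lemma tensmxZl m n p q c (A : 'M[C]_(m, n)) (D : 'M[C]_(p, q)) :
  tensmx (c *: A) D = c *: tensmx A D.
Proof. by apply/matrixP=> i j; rewrite !mxE mulrA. Qed.

Lemma tensmxZr m n p q c (A : 'M[C]_(m, n)) (D : 'M[C]_(p, q)) :
  tensmx A (c *: D) = c *: tensmx A D.
Proof. by apply/matrixP=> i j; rewrite !mxE mulrCA. Qed.

Lemma tensmx_suml I (r : seq I) (P : pred I) m n p q (F : I -> 'M[C]_(m, n))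
    (D : 'M[C]_(p, q)) :
  tensmx (\sum_(i <- r | P i) F i) D = \sum_(i <- r | P i) tensmx (F i) D.
Proof.
by apply: (big_morph (fun A => tensmx A D)) => [A B|]; rewrite ?tensmxDl ?tens0mx.
Qed.

Lemma tensmx_sumr I (r : seq I) (P : pred I) m n p q (A : 'M[C]_(m, n))
    (F : I -> 'M[C]_(p, q)) :
  tensmx A (\sum_(i <- r | P i) F i) = \sum_(i <- r | P i) tensmx A (F i).
Proof.
by apply: (big_morph (tensmx A)) => [B D|]; rewrite ?tensmxDr ?tensmx0.
Qed.

Lemma adjmx_tens m n p q (A : 'M[C]_(m, n)) (B : 'M[C]_(p, q)) :
  (tensmx A B)^t* = tensmx (A^t*) (B^t*).
Proof. by rewrite trmx_tens map_mxT. Qed.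

Lemma psdmx_tens m n (A : 'M[C]_m) (B : 'M[C]_n) :
  psdmx A -> psdmx B -> psdmx (tensmx A B).
Proof.
move=> /psdmx_sum_rank1[u ->] /psdmx_sum_rank1[v ->].
rewrite tensmx_suml; apply: psdmx_sum => i _; rewrite tensmx_sumr; apply: psdmx_sum => j _.
by rewrite -tensmx_mul -adjmx_tens; apply: psdmx_rank1.
Qed.

Lemma psdmx_tr_ge0 n (A : 'M[C]_n) : psdmx A -> 0 <= \tr A.
Proof.
move=> /psdmx_sum_rank1[v ->]; rewrite raddf_sum sumr_ge0 // => i _ /=.
rewrite mxtrace_mulC trace_mx11.
rewrite mxE sumr_ge0 // => j _.
by rewrite !mxE mulrC mul_conjC_ge0.
Qed.

Lemma psdmx_tr_eq0 n (A : 'M[C]_n) : psdmx A -> \tr A = 0 -> A = 0.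
Proof.
move=> /psdmx_sum_rank1[v ->]; rewrite raddf_sum /= => /eqP.
rewrite psumr_eq0; last first.
  by move=> i _; apply/psdmx_tr_ge0/psdmx_rank1.
move=> /allP h; apply: big1 => i _; have := h i (mem_index_enum _).
rewrite mxtrace_mulC trace_mx11 mxE psumr_eq0; last first.
  by move=> j _; rewrite !mxE mulrC mul_conjC_ge0.
move=> /allP hi; suff -> : v i = 0 by rewrite mul0mx.
apply/matrixP=> j k; rewrite ord1 !mxE.
have := hi j (mem_index_enum _).
by rewrite !mxE mulf_eq0 conjC_eq0 orbb => /eqP.
Qed.

(** Unnormalized separable matrices as finite sums of products; stability under a local operation is
    then an induction with three cases. *)
Inductive sepcone m n : 'M[C]_(m * n) -> Prop :=
| Sepcone0 : sepcone 0
| SepconeT A B of psdmx A & psdmx B : sepcone (tensmx A B)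
| SepconeD X Y of sepcone X & sepcone Y : sepcone (X + Y).

Lemma sepcone_sum m n I (r : seq I) (P : pred I) (F : I -> 'M[C]_(m * n)) :
  (forall i, P i -> sepcone (F i)) -> sepcone (\sum_(i <- r | P i) F i).
Proof. by move=> h; elim/big_ind: _ => //; [exact: Sepcone0|exact: SepconeD]. Qed.

Lemma sepconeZ m n c (X : 'M[C]_(m * n)) : 0 <= c -> sepcone X -> sepcone (c *: X).
Proof.
move=> c0; elim=> [|A B hA hB|Y Z _ hY _ hZ].
- by rewrite scaler0; exact: Sepcone0.
- by rewrite -tensmxZl; exact: (SepconeT (psdmxZ c0 hA) hB).
- by rewrite scalerDr; apply: SepconeD.
Qed.

Lemma sepcone_psd m n (X : 'M[C]_(m * n)) : sepcone X -> psdmx X.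
Proof.
elim=> [|A B hA hB|Y Z _ hY _ hZ]; [exact: psdmx0|exact: psdmx_tens|exact: psdmxD].
Qed.

Lemma tr_tens m n (A : 'M[C]_m) (B : 'M[C]_n) : \tr (tensmx A B) = \tr A * \tr B.
Proof.
rewrite /mxtrace mulr_sum; apply: eq_bigr => k _.
by rewrite mxE.
Qed.

(** The families are indexed by [nat] rather than by an ordinal, so that those of a sum are
    concatenated by shifting the index by [k]. *)
Lemma sepcone_sum_tens m n (X : 'M[C]_(m * n)) : sepcone X ->
  exists k (A : nat -> 'M[C]_m) (B : nat -> 'M[C]_n),
    [/\ forall i, (i < k)%N -> psdmx (A i), forall i, (i < k)%N -> psdmx (B i) &
        X = \sum_(i < k) tensmx (A i) (B i)].
Proof.
elim=> [|A B hA hB|Y Z _ [k [A [B [hA hB ->]]]] _ [k' [A' [B' [hA' hB' ->]]]]].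
- by exists 0%N, (fun=> 0), (fun=> 0); split=> //; rewrite big_ord0.
- exists 1%N, (fun=> A), (fun=> B); split=> //; exact/esym/big_ord1.
- exists (k + k')%N, (fun i => if (i < k)%N then A i else A' (i - k)%N),
    (fun i => if (i < k)%N then B i else B' (i - k)%N).
  split=> [i|i|].
  + by move=> h; have [ik|ki] := ltnP i k; [exact: hA|apply: hA'; rewrite ltn_subLR].
  + by move=> h; have [ik|ki] := ltnP i k; [exact: hB|apply: hB'; rewrite ltn_subLR].
  rewrite big_split_ord; congr (_ + _); apply: eq_bigr => i _ /=.
    by rewrite ltn_ord.
  by rewrite ltnNge leq_addr addKn.
Qed.

Definition conjmap m n (V : 'M[C]_(m, n)) (X : 'M[C]_n) : 'M[C]_m := V *m X *m V^t*.

Lemma conjmap_tens m n p q (V : 'M[C]_(m, n)) (W : 'M[C]_(p, q)) A B :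
  conjmap (tensmx V W) (tensmx A B) = tensmx (conjmap V A) (conjmap W B).
Proof. by rewrite /conjmap adjmx_tens !tensmx_mul. Qed.

Lemma conjmapD m n (V : 'M[C]_(m, n)) A B : conjmap V (A + B) = conjmap V A + conjmap V B.
Proof. by rewrite /conjmap mulmxDr mulmxDl. Qed.

Lemma conjmap0 m n (V : 'M[C]_(m, n)) : conjmap V 0 = 0.
Proof. by rewrite /conjmap mulmx0 mul0mx. Qed.

Lemma conjmap1 n (A : 'M[C]_n) : conjmap 1%:M A = A.
Proof. by rewrite /conjmap mul1mx trmx1 map_mx1 mulmx1. Qed.

Lemma sepcone_conj m n p q (V : 'M[C]_(m, n)) (W : 'M[C]_(p, q)) X :
  sepcone X -> sepcone (conjmap (tensmx V W) X).
Proof.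
elim=> [|A B hA hB|Y Z _ hY _ hZ]; first by rewrite conjmap0; apply: Sepcone0.
  by rewrite conjmap_tens; apply: SepconeT; apply: psdmx_congr.
by rewrite conjmapD; apply: SepconeD.
Qed.

Definition block m n (Z : 'M[C]_(m * n)) i j : 'M[C]_n :=
  \matrix_(k, l) Z (mxtens_index (i, k)) (mxtens_index (j, l)).

Lemma matrix_sum_block m n (Z : 'M[C]_(m * n)) :
  Z = \sum_i \sum_j tensmx (delta_mx i j) (block Z i j).
Proof.
apply/matrixP=> u v; case: (mxtens_indexP u) => i k; case: (mxtens_indexP v) => j l.
rewrite summxE (bigD1 i) //= summxE (bigD1 j) //= tensmxE !mxE !eqxx mul1r.
rewrite big1 => [|j' nj]; last first.
  by rewrite tensmxE !mxE eq_sym (negPf nj) andbF mul0r.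
rewrite addr0 big1 ?addr0 // => i' ni; rewrite summxE big1 // => j' _.
by rewrite tensmxE !mxE eq_sym (negPf ni) mul0r.
Qed.

End Forms.

(** * Block matrices with equal off-diagonal blocks *)

Section Rebit.
Variable C : numClosedFieldType.

Lemma big_ord2 (V : nmodType) (F : 'I_2 -> V) : \sum_i F i = F 0 + F 1.
Proof. by rewrite !big_ord_recl big_ord0 addr0; congr (F _ + F _); apply/val_inj. Qed.

Lemma ord2P (P : 'I_2 -> Prop) : P 0 -> P 1 -> forall i, P i.
Proof.
move=> P0 P1 [[|[|//]] h]; first by rewrite (_ : Ordinal h = 0) //; apply/val_inj.
by rewrite (_ : Ordinal h = 1) //; apply/val_inj.
Qed.

Lemma matrix2P (A B : 'M[C]_2) : A 0 0 = B 0 0 -> A 0 1 = B 0 1 ->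
  A 1 0 = B 1 0 -> A 1 1 = B 1 1 -> A = B.
Proof. by move=> h1 h2 h3 h4; apply/matrixP; apply: ord2P; apply: ord2P. Qed.

Definition mat2 (a b c d : C) : 'M[C]_2 :=
  \matrix_(i, j) (if i == 0 then if j == 0 then a else b else if j == 0 then c else d).

Lemma mat2E (a b c d : C) : (mat2 a b c d 0 0 = a) * (mat2 a b c d 0 1 = b) *
  (mat2 a b c d 1 0 = c) * (mat2 a b c d 1 1 = d).
Proof. by rewrite !mxE. Qed.

Lemma mulmx2E (A B : 'M[C]_2) i j : (A *m B) i j = A i 0 * B 0 j + A i 1 * B 1 j.
Proof. by rewrite mxE big_ord2. Qed.

Lemma psdmx_diag_eq0 n (M : 'M[C]_n) k j : psdmx M -> M k k = 0 -> M k j = 0.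
Proof.
move=> /psdmx_sum_rank1[v ->]; rewrite summxE => /eqP; rewrite psumr_eq0; last first.
  by move=> i _; rewrite mxE big_ord1 !mxE mul_conjC_ge0.
move=> /allP h; rewrite summxE big1 // => i _; have := h i (mem_index_enum _).
by rewrite !mxE !big_ord1 !mxE mulf_eq0 conjC_eq0 orbb => /eqP ->; rewrite mul0r.
Qed.

Lemma herm_diag n (A : 'M[C]_n) : A^t* = A ->
  exists2 P : 'M[C]_n, P \in unitmx & exists d, P *m P^t* = 1%:M /\ conjmap P A = diag_mx d.
Proof.
move=> /spectral_decomposition[P PP [d dE _]]; exists P; last by exists d.
by case: (mulmx1_unit PP).
Qed.

Lemma psdmx_diag_ge0 n (A : 'M[C]_n) k : psdmx A -> 0 <= A k k.
Proof.
move=> /psdmx_sum_rank1[v ->]; rewrite summxE sumr_ge0 // => i _.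
by rewrite mxE big_ord1 !mxE mul_conjC_ge0.
Qed.

Lemma conjmapM m n p (V : 'M[C]_(m, n)) (W : 'M[C]_(n, p)) A :
  conjmap (V *m W) A = conjmap V (conjmap W A).
Proof. by rewrite /conjmap adjmxM !mulmxA. Qed.

(** Sylvester's normal form: a unitary diagonalization, then the scaling 1 / sqrt d where d is
    nonzero. The value 1 elsewhere keeps the congruence invertible. *)
Lemma psdmx_diag01 n (A : 'M[C]_n) : psdmx A ->
  exists2 V : 'M[C]_n, V \in unitmx &
    exists2 d : 'rV[C]_n, conjmap V A = diag_mx d & forall k, d 0 k = 0 \/ d 0 k = 1.
Proof.
move=> hA; have [P Pu [d [_ E]]] := herm_diag (psdmx_herm hA).
have d_ge0 k : 0 <= d 0 k.
  by have := psdmx_diag_ge0 k (psdmx_congr P hA); rewrite -/(conjmap P A) E !mxE eqxx.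
pose e : 'rV[C]_n := \row_k (if d 0 k == 0 then 1 else (sqrtC (d 0 k))^-1).
have e_neq0 k : e 0 k != 0.
  by rewrite mxE; have [_|h] := eqVneq (d 0 k) 0; rewrite ?oner_eq0 ?invr_eq0 ?sqrtC_eq0.
exists (diag_mx e *m P).
  rewrite unitmx_mul Pu andbT unitmxE det_diag unitfE.
  by apply/prodf_neq0 => k _.
exists (\row_k (if d 0 k == 0 then 0 else 1)); last first.
  by move=> k; rewrite mxE; case: eqP; [left|right].
rewrite conjmapM E /conjmap tr_diag_mx map_diag_mx !mulmx_diag.
congr diag_mx; apply/matrixP=> i k; rewrite ord1 !mxE.
case: eqP => [->|/eqP h]; first by rewrite mulr0 mul0r.
have hr : ((sqrtC (d 0 k))^-1)^*%R = (sqrtC (d 0 k))^-1.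
  by apply: conj_Creal; rewrite ger0_real // invr_ge0 sqrtC_ge0.
rewrite [X in _ * X]hr.
rewrite -{2}(sqrtCK (d 0 k)) expr2 mulrA mulVf ?sqrtC_eq0 // mul1r mulfV //.
by rewrite sqrtC_eq0.
Qed.

Definition bmx (A B B' D : 'M[C]_2) : 'M[C]_(2 * 2) :=
  tensmx (delta_mx 0 0) A + tensmx (delta_mx 0 1) B +
  tensmx (delta_mx 1 0) B' + tensmx (delta_mx 1 1) D.

Lemma bmxE A B B' D i j k l :
  bmx A B B' D (mxtens_index (i, k)) (mxtens_index (j, l)) =
  (i == 0)%:R * (j == 0)%:R * A k l + (i == 0)%:R * (j == 1)%:R * B k l +
  (i == 1)%:R * (j == 0)%:R * B' k l + (i == 1)%:R * (j == 1)%:R * D k l.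
Proof. by rewrite /bmx !mxDE !tensmxE !mxE -!mulnb !natrM. Qed.

Lemma bmx_block A B B' D :
  [/\ block (bmx A B B' D) 0 0 = A, block (bmx A B B' D) 0 1 = B,
      block (bmx A B B' D) 1 0 = B' & block (bmx A B B' D) 1 1 = D].
Proof.
by split; apply/matrixP=> k l; rewrite mxE bmxE /=; rewrite !(mul0r, mulr0, mul1r, add0r, addr0).
Qed.

Lemma sum_mxtens m n (V : nmodType) (F : 'I_(m * n) -> V) :
  \sum_u F u = \sum_i \sum_k F (mxtens_index (i, k)).
Proof.
rewrite pair_big /= (reindex (fun p : 'I_m * 'I_n => mxtens_index p)) /=; last first.
  by exists (@mxtens_unindex m n) => [p _|u _]; rewrite ?mxtens_indexK ?mxtens_unindexK.
by apply: eq_bigr => -[i k] _.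
Qed.

Lemma form_block m n (Z : 'M[C]_(m * n)) (v : 'cV[C]_(m * n)) :
  (v^t* *m Z *m v) 0 0 = \sum_i \sum_j
    ((\col_k v (mxtens_index (i, k)) 0)^t* *m block Z i j *m
      (\col_k v (mxtens_index (j, k)) 0)) 0 0.
Proof.
rewrite mxE sum_mxtens [RHS]exchange_big; apply: eq_bigr => j _ /=.
under [RHS]eq_bigr do rewrite mxE.
rewrite [RHS]exchange_big; apply: eq_bigr => l _ /=.
rewrite [X in X * _]mxE sum_mxtens big_distrl; apply: eq_bigr => i _ /=.
rewrite mxE [in RHS]mxE; congr (_ * _).
by apply: eq_bigr => k _; rewrite !mxE.
Qed.

Lemma psdmx_bmxP A B B' D : psdmx (bmx A B B' D) <->
  forall b0 b1 : 'cV[C]_2, 0 <= (b0^t* *m A *m b0) 0 0 + (b0^t* *m B *m b1) 0 0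
    + (b1^t* *m B' *m b0) 0 0 + (b1^t* *m D *m b1) 0 0.
Proof.
have [e00 e01 e10 e11] := bmx_block A B B' D.
split=> h => [b0 b1|v].
  have := h (\col_u (if (mxtens_unindex u).1 == 0 then b0 else b1) (mxtens_unindex u).2 0).
  rewrite form_block !big_ord2 e00 e01 e10 e11 !addrA.
  have -> : \col_k (\col_u (if (mxtens_unindex u).1 == 0 then b0 else b1)
    (mxtens_unindex u).2 0) (@mxtens_index 2 2 (0, k)) 0 = b0.
    by apply/matrixP=> k j; rewrite !mxE mxtens_indexK ord1.
  have -> // : \col_k (\col_u (if (mxtens_unindex u).1 == 0 then b0 else b1)
    (mxtens_unindex u).2 0) (@mxtens_index 2 2 (1, k)) 0 = b1.
    by apply/matrixP=> k j; rewrite !mxE mxtens_indexK ord1.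
by rewrite form_block !big_ord2 e00 e01 e10 e11 !addrA.
Qed.

Lemma psdmx_bmx_herm A B B' D : psdmx (bmx A B B' D) -> B^t* = B'.
Proof.
move=> /psdmx_herm h; apply/matrixP=> k l.
have := congr1 (fun Z : 'M[C]_(2 * 2) => Z (mxtens_index (1, k)) (mxtens_index (0, l))) h.
by rewrite !adjmxE !bmxE /= !(mul0r, mulr0, mul1r, add0r, addr0).
Qed.

Lemma psdmx_bmx_diag A B B' D : psdmx (bmx A B B' D) -> psdmx A.
Proof.
move=> /psdmx_bmxP h v; have := h v 0.
by rewrite !mulmx0 trmx0 map_mx0 !mul0mx !mxE !addr0.
Qed.

Lemma conjmap_bmx (V A B B' D : 'M[C]_2) :
  conjmap (tensmx 1%:M V) (bmx A B B' D) =
  bmx (conjmap V A) (conjmap V B) (conjmap V B') (conjmap V D).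
Proof. by rewrite /bmx !conjmapD !conjmap_tens !conjmap1. Qed.

Lemma conjmapK n (V : 'M[C]_n) A : V \in unitmx -> conjmap (invmx V) (conjmap V A) = A.
Proof.
move=> hV; by rewrite -conjmapM mulVmx // conjmap1.
Qed.

Lemma conjmap_adj n (V A : 'M[C]_n) : (conjmap V A)^t* = conjmap V (A^t*).
Proof. by rewrite /conjmap !adjmxM adjmxK mulmxA. Qed.

Lemma psdmx_bmx_conj (V A B B' D : 'M[C]_2) : psdmx (bmx A B B' D) ->
  psdmx (bmx (conjmap V A) (conjmap V B) (conjmap V B') (conjmap V D)).
Proof.
by move=> h; rewrite -conjmap_bmx; apply: psdmx_congr.
Qed.

Lemma rebit_simdiag (A B D : 'M[C]_2) : psdmx (bmx A B B D) ->
  exists2 V : 'M[C]_2, V \in unitmx & exists d e : 'rV[C]_2,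
    conjmap V A = diag_mx d /\ conjmap V B = diag_mx e.
Proof.
move=> hM; have hA := psdmx_bmx_diag hM; have hB := psdmx_bmx_herm hM.
have [V Vu [d dE d01]] := psdmx_diag01 hA.
have hMV := psdmx_bmx_conj V hM.
have BVh : (conjmap V B)^t* = conjmap V B by rewrite conjmap_adj hB.
have [d1|] := pselect (forall k, d 0 k = 1).
  have [P Pu [e [PP eE]]] := herm_diag BVh.
  exists (P *m V); first by rewrite unitmx_mul Pu.
  exists d, e; rewrite !conjmapM eE dE; split=> //.
  have -> : d = const_mx 1 by apply/matrixP=> i j; rewrite ord1 d1 mxE.
  by rewrite diag_const_mx /conjmap mulmx1.
move=> /existsNP[k dk]; have dk0 : d 0 k = 0 by case: (d01 k).
have Bk j : conjmap V B k j = 0.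
  have := psdmx_diag_eq0 (k := mxtens_index (0, k)) (mxtens_index (1, j)) hMV.
  rewrite !bmxE dE /= !(mul0r, mulr0, mul1r, add0r, addr0); apply.
  by rewrite mxE eqxx dk0.
have Bk' j : conjmap V B j k = 0 by rewrite -BVh adjmxE Bk conjC0.
exists V => //; exists d, (\row_j conjmap V B j j); split=> //.
apply/matrixP=> i j; rewrite [RHS]mxE [X in _ = X *+ _]mxE.
case: eqP => [->|/eqP nij]; first by rewrite mulr1n.
rewrite mulr0n; have [ik|nik] := eqVneq i k; first by rewrite ik Bk.
(* In size 2, two distinct indices of which the first is not [k] leave only [j = k]. *)
have -> : j = k; last exact: Bk'.
by move: i j k nij nik {dk dk0 Bk Bk'}; do 3![apply: ord2P]; rewrite ?eqxx.
Qed.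

Lemma psdmx_delta k : psdmx (delta_mx k k : 'M[C]_2).
Proof.
have -> : delta_mx k k = (delta_mx k 0 : 'cV[C]_2) *m (delta_mx k 0)^t*.
  by rewrite trmx_delta map_delta_mx mul_delta_mx.
exact: psdmx_rank1.
Qed.

(** This is 1 / a times the rank-one matrix of the vector (a, b). For a = 0 the quotient is 0 by
    convention and the whole matrix vanishes. *)
Lemma psdmx_rank1_real (a b : C) : 0 <= a -> b^*%R = b -> (a = 0 -> b = 0) ->
  psdmx (mat2 a b b (b ^+ 2 / a)).
Proof.
move=> a0 hb ab; have [aE|an0] := eqVneq a 0.
  suff -> : mat2 a b b (b ^+ 2 / a) = 0 by apply: psdmx0.
  by apply: matrix2P; rewrite !mat2E mxE ?aE ?ab // expr0n mul0r.
have -> : mat2 a b b (b ^+ 2 / a) = a^-1 *: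
    ((\col_i (if i == 0 then a else b)) *m (\col_i (if i == 0 then a else b))^t*).
  have ha : a^*%R = a by apply/conj_Creal/ger0_real.
  by apply: matrix2P; rewrite !mat2E mxZE mxE big_ord1 !mxE /= ?hb ?ha; field.
by apply: psdmxZ; [rewrite invr_ge0|apply: psdmx_rank1].
Qed.

Lemma form_diag (d : 'rV[C]_2) (u v : 'cV[C]_2) :
  (u^t* *m diag_mx d *m v) 0 0 =
  (u 0 0)^*%R * d 0 0 * v 0 0 + (u 1 0)^*%R * d 0 1 * v 1 0.
Proof. by rewrite mul_mx_diag mxE big_ord2 !mxE. Qed.

Lemma bmx_diag_sepcone (d e : 'rV[C]_2) D :
  psdmx (bmx (diag_mx d) (diag_mx e) (diag_mx e) D) ->
  sepcone (bmx (diag_mx d) (diag_mx e) (diag_mx e) D).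
Proof.
move=> hM; have hd k : 0 <= d 0 k.
  by have := psdmx_diag_ge0 k (psdmx_bmx_diag hM); rewrite mxE eqxx.
have he k : (e 0 k)^*%R = e 0 k.
  have := congr1 (fun Z : 'M[C]_2 => Z k k) (psdmx_bmx_herm hM).
  by rewrite adjmxE mxE eqxx mulr1n.
have hde k : d 0 k = 0 -> e 0 k = 0.
  move=> dk; have := psdmx_diag_eq0 (k := mxtens_index (0, k)) (mxtens_index (1, k)) hM.
  rewrite !bmxE /= !(mul0r, mulr0, mul1r, add0r, addr0) !mxE eqxx !mulr1n.
  exact.
(* Schur complement of [diag_mx d]; where d vanishes so does e, and the quotient is 0. *)
pose D' := D - diag_mx (\row_k ((e 0 k) ^+ 2 / d 0 k)).
have hD' : psdmx D'.
  (* For given [v], the vector [u] minimizes the block form over its first component, and the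
     minimum is the form of [D'] at [v]. *)
  move=> v; pose u : 'cV[C]_2 := \col_k (- (e 0 k / d 0 k) * v k 0).
  have := (psdmx_bmxP _ _ _ _).1 hM u v; congr (0 <= _).
  have -> : (v^t* *m D' *m v) 0 0 = (v^t* *m D *m v) 0 0
      - (v^t* *m diag_mx (\row_k ((e 0 k) ^+ 2 / d 0 k)) *m v) 0 0.
    by rewrite /D' mulmxBr mulmxBl mxDE; congr (_ + _); rewrite mxE.
  have term k : (u k 0)^*%R * d 0 k * u k 0 + (u k 0)^*%R * e 0 k * v k 0 +
      (v k 0)^*%R * e 0 k * u k 0 = - ((v k 0)^*%R * ((e 0 k) ^+ 2 / d 0 k) * v k 0).
    rewrite /u mxE; have [dk|dk] := eqVneq (d 0 k) 0.
      by rewrite (hde _ dk) expr0n /= !(mul0r, mulr0, oppr0, addr0).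
    have hd' : (d 0 k)^*%R = d 0 k by apply/conj_Creal/ger0_real.
    by rewrite !rmorphM /= rmorphN /= rmorphM /= fmorphV /= he hd'; field.
  clearbody u; rewrite !form_diag.
  do 2!rewrite [(\row__ _) _ _]mxE.
  move: ((v^t* *m D *m v) 0 0) => x; have t0 := term 0; have t1 := term 1.
  transitivity ((- ((v 0 0)^*%R * ((e 0 0) ^+ 2 / d 0 0) * v 0 0))
    + (- ((v 1 0)^*%R * ((e 0 1) ^+ 2 / d 0 1) * v 1 0)) + x).
    by rewrite -t0 -t1; ring.
  by ring.
have psdk k : psdmx (mat2 (d 0 k) (e 0 k) (e 0 k) ((e 0 k) ^+ 2 / d 0 k)).
  by apply: psdmx_rank1_real => //; apply: hde.
have diagE (r : 'rV[C]_2) : (diag_mx r 0 0 = r 0 0) * (diag_mx r 0 1 = 0) *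
    (diag_mx r 1 0 = 0) * (diag_mx r 1 1 = r 0 1) by rewrite !mxE.
have D'E i j : D' i j = D i j - diag_mx (\row_k ((e 0 k) ^+ 2 / d 0 k)) i j.
  by rewrite /D' mxDE; congr (_ + _); rewrite mxE.
have -> : bmx (diag_mx d) (diag_mx e) (diag_mx e) D =
    tensmx (mat2 (d 0 0) (e 0 0) (e 0 0) ((e 0 0) ^+ 2 / d 0 0)) (delta_mx 0 0) +
    tensmx (mat2 (d 0 1) (e 0 1) (e 0 1) ((e 0 1) ^+ 2 / d 0 1)) (delta_mx 1 1) +
    tensmx (delta_mx 1 1) D'.
  apply/matrixP=> u v; case: (mxtens_indexP u) => i k; case: (mxtens_indexP v) => j l.
  rewrite bmxE !mxDE !tensmxE D'E.
  by move: i j k l; do 4![apply: ord2P];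
    rewrite !mat2E ![delta_mx _ _ _ _]mxE !diagE /= ?[(\row__ _) _ _]mxE; ring.
exact: (SepconeD (SepconeD (SepconeT (psdk 0) (psdmx_delta 0))
  (SepconeT (psdk 1) (psdmx_delta 1))) (SepconeT (psdmx_delta 1) hD')).
Qed.

(* A congruence brings A to a 0/1 diagonal; where A vanishes so does B, and on the
   rest B can be diagonalized by a unitary, which leaves A unchanged.  Then the matrix is
   the sum of tensmx [[d, e], [e, e ^ 2 / d]] E_kk over k and of a psd matrix in the last
   block. *)
Lemma rebit_separable (A B D : 'M[C]_2) : psdmx (bmx A B B D) -> sepcone (bmx A B B D).
Proof.
move=> hM; have [V Vu [d [e [dE eE]]]] := rebit_simdiag hM.
rewrite -(conjmapK A Vu) -(conjmapK B Vu) -(conjmapK D Vu) -conjmap_bmx.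
apply: sepcone_conj.
by have := psdmx_bmx_conj V hM; rewrite dE eE; apply: bmx_diag_sepcone.
Qed.

End Rebit.

(** * Separability of the images of rank-one inputs *)

Section Families.
Variables (C : numClosedFieldType) (R : realFieldType) (toC : {rmorphism R -> C}).
Variable cabs : C -> R.
Hypothesis toC_ge0 : forall x, (0 <= toC x) = (0 <= x).
Hypothesis cabsE : forall z, toC (cabs z) = `|z|.

Let toCI x y : toC x = toC y -> x = y.
Proof.
move=> h; apply/eqP; rewrite eq_le -[x <= y]subr_ge0 -[y <= x]subr_ge0 -!toC_ge0.
by rewrite !rmorphB /= h subrr lexx.
Qed.

Let toC_le x y : (toC x <= toC y) = (x <= y).
Proof. by rewrite -[RHS]subr_ge0 -toC_ge0 rmorphB subr_ge0. Qed.

Lemma cabs_ge0 z : 0 <= cabs z.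
Proof. by rewrite -toC_ge0 cabsE. Qed.

Lemma cabsM z w : cabs (z * w) = cabs z * cabs w.
Proof. by apply: toCI; rewrite rmorphM /= !cabsE normrM. Qed.

Lemma cabsD z w : cabs (z + w) <= cabs z + cabs w.
Proof. by rewrite -toC_le rmorphD /= !cabsE ler_normD. Qed.

Lemma cabs_conj z : cabs (z^*%R) = cabs z.
Proof. by apply: toCI; rewrite !cabsE norm_conjC. Qed.

Lemma cabsN z : cabs (- z) = cabs z.
Proof. by apply: toCI; rewrite !cabsE normrN. Qed.

Lemma cabs_toC (x : R) : 0 <= x -> cabs (toC x) = x.
Proof. by move=> x0; apply: toCI; rewrite cabsE ger0_norm // toC_ge0. Qed.

Lemma conj_toC (x : R) : (toC x)^*%R = toC x.
Proof.
have [x0|x0] := leP 0 x; first by apply/conj_Creal/ger0_real; rewrite toC_ge0.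
rewrite -[x]opprK rmorphN rmorphN /= conj_Creal // ger0_real // toC_ge0.
by rewrite oppr_ge0 ltW.
Qed.

Lemma sqr_cabs z : toC (cabs z ^+ 2) = z * z^*%R.
Proof. by rewrite rmorphXn /= cabsE normCK. Qed.

Lemma addr_conj_ge0 (r : R) z : 2 * cabs z <= r -> 0 <= toC r + (z + z^*%R).
Proof.
rewrite -toC_le => h; apply: (@le_trans _ _ (2 * `|z| + (z + z^*%R))); last first.
  by rewrite lerD2r; move: h; rewrite rmorphM rmorph_nat /= cabsE.
have zr : z + z^*%R \is Num.real by rewrite CrealE rmorphD /= conjCK addrC.
have : `|z + z^*%R| <= 2 * `|z|.
  by apply: (le_trans (ler_normD _ _)); rewrite norm_conjC mulr_natl.
by rewrite real_ler_norml // => /andP[+ _]; rewrite -subr_ge0 opprK addrC.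
Qed.

(** Cauchy-Schwarz bounds the square of d d' + t t' by p q b0 b1, and 4 p q b0 b1 <= (p b0 + q b1) ^
    2; comparing squares avoids roots. *)
Lemma cauchy_amgm (d t d' t' p q b0 b1 : R) :
  0 <= p -> 0 <= q -> 0 <= b0 -> 0 <= b1 ->
  d ^+ 2 + t ^+ 2 <= p * q -> d' ^+ 2 + t' ^+ 2 <= b0 * b1 ->
  2 * (d * d' + t * t') <= p * b0 + q * b1.
Proof.
move=> p0 q0 b00 b10 h h'; have u0 : 0 <= p * b0 + q * b1 by rewrite addr_ge0 ?mulr_ge0.
have [s0|s0] := leP (d * d' + t * t') 0; first by lra.
rewrite -ler_sqr ?nnegrE //; last by rewrite mulr_ge0 // ltW.
have h1 : (d * d' + t * t') ^+ 2 <= (d ^+ 2 + t ^+ 2) * (d' ^+ 2 + t' ^+ 2).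
  rewrite -subr_ge0; have -> : (d ^+ 2 + t ^+ 2) * (d' ^+ 2 + t' ^+ 2) - (d * d' + t * t') ^+ 2
    = (d * t' - t * d') ^+ 2 by ring.
  exact: sqr_ge0.
have h2 : (d ^+ 2 + t ^+ 2) * (d' ^+ 2 + t' ^+ 2) <= (p * q) * (b0 * b1).
  by apply: ler_pM => //; rewrite addr_ge0 ?sqr_ge0.
have h3 : 4 * ((p * q) * (b0 * b1)) <= (p * b0 + q * b1) ^+ 2.
  rewrite -subr_ge0; have -> : (p * b0 + q * b1) ^+ 2 - 4 * (p * q * (b0 * b1))
    = (p * b0 - q * b1) ^+ 2 by ring.
  exact: sqr_ge0.
by rewrite exprMn; lra.
Qed.

Lemma form2E (u v : 'cV[C]_2) (A : 'M[C]_2) : (u^t* *m A *m v) 0 0 =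
  (u 0 0)^*%R * (A 0 0 * v 0 0 + A 0 1 * v 1 0) +
  (u 1 0)^*%R * (A 1 0 * v 0 0 + A 1 1 * v 1 0).
Proof. by rewrite mxE big_ord2 !mxE !big_ord2 !mxE; ring. Qed.

Lemma psdmx_mat2 (a b : R) (c : C) : 0 <= a -> 0 <= b -> cabs c ^+ 2 <= a * b ->
  psdmx (mat2 (toC a) c c^*%R (toC b)).
Proof.
move=> a0 b0 h v; rewrite form2E !mat2E; set u := v 0 0; set w := v 1 0.
have -> : u^*%R * (toC a * u + c * w) + w^*%R * (c^*%R * u + toC b * w) =
    toC (a * cabs u ^+ 2 + b * cabs w ^+ 2) + (u^*%R * c * w + (u^*%R * c * w)^*%R).
  transitivity (toC a * toC (cabs u ^+ 2) + toC b * toC (cabs w ^+ 2) +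
    (u^*%R * c * w + (u^*%R * c * w)^*%R)); last by ring.
  by rewrite !sqr_cabs !rmorphM /= conjCK; ring.
apply: addr_conj_ge0; rewrite !cabsM cabs_conj.
have := @cauchy_amgm 0 (cabs c) 0 (cabs u * cabs w) a b (cabs u ^+ 2) (cabs w ^+ 2).
rewrite !sqr_ge0 expr0n /= !add0r exprMn !mulr0 add0r => /(_ a0 b0 isT isT h (lexx _)).
by lra.
Qed.

Definition outer (a b : 'cV[C]_2) : 'M[C]_2 := a *m b^t*.

Lemma outerE (a b : 'cV[C]_2) i j : outer a b i j = a i 0 * (b j 0)^*%R.
Proof. by rewrite mxE big_ord1 adjmxE. Qed.

Definition dot (a b : 'cV[C]_2) : C := (a 0 0)^*%R * b 0 0 + (a 1 0)^*%R * b 1 0.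
Definition sqn (a : 'cV[C]_2) : R := cabs (a 0 0) ^+ 2 + cabs (a 1 0) ^+ 2.
Definition det2 (a b : 'cV[C]_2) : C := a 0 0 * b 1 0 - a 1 0 * b 0 0.

Lemma sqn_ge0 a : 0 <= sqn a.
Proof. by rewrite addr_ge0 ?sqr_ge0. Qed.

Lemma dot_self a : dot a a = toC (sqn a).
Proof. by rewrite /sqn rmorphD /= !sqr_cabs /dot; ring. Qed.

Lemma dotC a b : dot b a = (dot a b)^*%R.
Proof. by rewrite /dot rmorphD !rmorphM /= !conjCK; ring. Qed.

Lemma lagrange a b : cabs (det2 a b) ^+ 2 + cabs (dot a b) ^+ 2 = sqn a * sqn b.
Proof.
apply: toCI; rewrite rmorphD [RHS]rmorphM /= !sqr_cabs -!dot_self /det2 /dot.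
by rewrite !(rmorphD, rmorphB, rmorphM) /= !conjCK; ring.
Qed.

(** Binet-Cauchy: the determinant of the table of products <ai, bj> factors into the determinants of
    (a0, a1), conjugated, and of (b0, b1). *)
Lemma dot_det a0 a1 b0 b1 :
  dot a1 b0 * dot a0 b1 = dot a0 b0 * dot a1 b1 - (det2 a0 a1)^*%R * det2 b0 b1.
Proof. by rewrite /det2 /dot !(rmorphD, rmorphB, rmorphM) /=; ring. Qed.

Lemma cabs_dot_cross a0 a1 b0 b1 : cabs (dot a1 b0) * cabs (dot a0 b1) <=
  cabs (dot a0 b0) * cabs (dot a1 b1) + cabs (det2 a0 a1) * cabs (det2 b0 b1).
Proof.
rewrite -cabsM dot_det; apply: (le_trans (cabsD _ _)).
by rewrite cabsN !cabsM cabs_conj.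
Qed.

Lemma form_outer (u v a b : 'cV[C]_2) : (u^t* *m outer a b *m v) 0 0 = (dot a u)^*%R * dot b v.
Proof. by rewrite form2E !outerE /dot rmorphD !rmorphM /= !conjCK; ring. Qed.

Lemma form_scalar (u v : 'cV[C]_2) c : (u^t* *m c%:M *m v) 0 0 = c * dot u v.
Proof. by rewrite form2E !mxE /= /dot; ring. Qed.

Lemma form_add (u v : 'cV[C]_2) (A B : 'M[C]_2) :
  (u^t* *m (A + B) *m v) 0 0 = (u^t* *m A *m v) 0 0 + (u^t* *m B *m v) 0 0.
Proof. by rewrite mulmxDr mulmxDl mxDE. Qed.

Lemma form_scale (u v : 'cV[C]_2) c (A : 'M[C]_2) :
  (u^t* *m (c *: A) *m v) 0 0 = c * (u^t* *m A *m v) 0 0.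
Proof. by rewrite -scalemxAr -scalemxAl mxZE. Qed.

(** Value at [outer a b] of the depolarizing map X |-> 2 X + y tr(X) I, that is of
    [pauli_op (1 + y) 1 1 1]. *)
Definition isoop (y : R) (a b : 'cV[C]_2) : 'M[C]_2 :=
  2 *: outer a b + (toC y * dot b a)%:M.

Lemma form_iso y a b u v : (u^t* *m isoop y a b *m v) 0 0 =
  2 * ((dot a u)^*%R * dot b v) + toC y * dot b a * dot u v.
Proof. by rewrite form_add form_scale form_outer form_scalar. Qed.

(** To be read with xij = <ai, bj>, t = <a0, a1>, g = <b0, b1>, d and e the moduli of the
    determinants, N and B the squared norms. Replacing |x10 x01| by |x00 x11| + d e leaves d e + |t
    g|, which [cauchy_amgm] bounds by Lagrange's identity; the terms |x00 x11| go into the squares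
    since y <= 1. *)
Lemma iso_bound y (x00 x11 x10 x01 t g : C) (d e N0 N1 B0 B1 : R) : 0 <= y <= 1 ->
  0 <= N0 -> 0 <= N1 -> 0 <= B0 -> 0 <= B1 ->
  cabs x10 * cabs x01 <= cabs x00 * cabs x11 + d * e ->
  d ^+ 2 + cabs t ^+ 2 = N0 * N1 -> e ^+ 2 + cabs g ^+ 2 = B0 * B1 ->
  0 <= toC (4 * (cabs x00 ^+ 2 + cabs x11 ^+ 2) + 2 * y * (N0 * B0 + N1 * B1)) +
  (toC (2 * y) * (x00^*%R * x11 + x10^*%R * x01) + toC (y ^+ 2) * (t + t^*%R) * g +
   (toC (2 * y) * (x00^*%R * x11 + x10^*%R * x01) + toC (y ^+ 2) * (t + t^*%R) * g)^*%R).
Proof.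
move=> /andP[y0 y1] N00 N10 B00 B10 hx hN hB; apply: addr_conj_ge0.
have hS : 2 * (d * e + cabs t * cabs g) <= N0 * B0 + N1 * B1.
  by apply: cauchy_amgm => //; rewrite ?hN ?hB.
set z := (X in 2 * cabs X).
have hz : cabs z <= 2 * y * (cabs x00 * cabs x11 + cabs x10 * cabs x01) +
    y ^+ 2 * (2 * cabs t) * cabs g.
  apply: (le_trans (cabsD _ _)); rewrite !cabsM !cabs_toC ?sqr_ge0 ?mulr_ge0 //.
  apply: lerD.
    apply: ler_wpM2l; first by rewrite mulr_ge0.
    by apply: (le_trans (cabsD _ _)); rewrite !cabsM !cabs_conj.
  apply: ler_wpM2r; first exact: cabs_ge0.
  apply: ler_wpM2l; first exact: sqr_ge0.
  by apply: (le_trans (cabsD _ _)); rewrite cabs_conj mulr_natl.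
move: (cabs z) (cabs x00) (cabs x11) (cabs x10 * cabs x01) (cabs t) (cabs g)
  (cabs_ge0 x00) (cabs_ge0 x11) (cabs_ge0 t) (cabs_ge0 g) hx hS hz
  => Z p q r T G p0 q0 T0 G0 hx hS hz.
have h1 : y * (2 * (p * q)) <= p ^+ 2 + q ^+ 2.
  apply: (@le_trans _ _ (2 * (p * q))); first by rewrite ler_piMl // !mulr_ge0.
  by rewrite -subr_ge0; have -> : p ^+ 2 + q ^+ 2 - 2 * (p * q) = (p - q) ^+ 2 by [ring]; apply: sqr_ge0.
have h2 : y ^+ 2 * (T * G) <= y * (T * G).
  by rewrite expr2 -mulrA ler_piMl // !mulr_ge0.
have h3 := ler_wpM2l y0 hS; have h4 := ler_wpM2l y0 hx; lra.
Qed.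

Lemma iso_separable y a0 a1 : 0 <= y <= 1 ->
  sepcone (bmx (2 *: isoop y a0 a0) (toC y *: (isoop y a0 a1 + isoop y a1 a0))
    (toC y *: (isoop y a0 a1 + isoop y a1 a0)) (2 *: isoop y a1 a1)).
Proof.
move=> y01; apply: rebit_separable; apply/psdmx_bmxP => b0 b1.
rewrite 4!form_scale 2!form_add 6!form_iso.
have := @iso_bound y (dot a0 b0) (dot a1 b1) (dot a1 b0) (dot a0 b1) (dot a0 a1)
  (dot b0 b1) (cabs (det2 a0 a1)) (cabs (det2 b0 b1)) _ _ _ _ y01
  (sqn_ge0 a0) (sqn_ge0 a1) (sqn_ge0 b0) (sqn_ge0 b1) (cabs_dot_cross _ _ _ _)
  (lagrange a0 a1) (lagrange b0 b1).
congr (0 <= _); rewrite (dotC a0 a1) (dotC b0 b1) !dot_self.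
rewrite (_ : toC (4 * _ + _) = 4 * (toC (cabs (dot a0 b0) ^+ 2) + toC (cabs (dot a1 b1) ^+ 2)) +
  2 * toC y * (toC (sqn a0) * toC (sqn b0) + toC (sqn a1) * toC (sqn b1))); last by ring.
rewrite !sqr_cabs.
move: (dot a0 b0) (dot a1 b1) (dot a1 b0) (dot a0 b1) (dot a0 a1) (dot b0 b1)
  (sqn a0) (sqn a1) (sqn b0) (sqn b1) => x00 x11 x10 x01 t g N0 N1 B0 B1.
by rewrite !(rmorphD Num.conj, rmorphM Num.conj) /= !conjCK !conj_toC; ring.
Qed.

(** The expression is h times that of [key], which is bounded as in [iso_bound], plus 1 / 2 - h
    times the squares |x00 + x11| ^ 2 + |x10 + x01| ^ 2. *)
Lemma depolarized_bound h (x00 x11 x10 x01 g : C) (d e t B0 B1 P Q : R) :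
  0 <= h -> 2 * h <= 1 ->
  0 <= P -> 0 <= Q -> 0 <= B0 -> 0 <= B1 -> 0 <= t ->
  cabs x10 * cabs x01 <= cabs x00 * cabs x11 + d * e ->
  d ^+ 2 + t ^+ 2 <= P * Q -> e ^+ 2 + cabs g ^+ 2 = B0 * B1 ->
  0 <= toC ((1 / 2 + h) * (cabs x00 ^+ 2 + cabs x11 ^+ 2) +
     (1 / 2 - h) * (cabs x10 ^+ 2 + cabs x01 ^+ 2) + h * (P * B0 + Q * B1)) +
  (toC (1 / 2) * (x00^*%R * x11 + x10^*%R * x01) + toC (h * t) * g +
   (toC (1 / 2) * (x00^*%R * x11 + x10^*%R * x01) + toC (h * t) * g)^*%R).
Proof.
move=> h0 h1 P0 Q0 B00 B10 t0 hx hN hB.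
have hS : 2 * (d * e + t * cabs g) <= P * B0 + Q * B1.
  by apply: cauchy_amgm => //; rewrite hB.
pose z := x00^*%R * x11 + x10^*%R * x01 + toC t * g.
have key : 0 <= toC (2 * (cabs x00 ^+ 2 + cabs x11 ^+ 2) + (P * B0 + Q * B1)) + (z + z^*%R).
  apply: addr_conj_ge0.
  have hz : cabs z <= cabs x00 * cabs x11 + cabs x10 * cabs x01 + t * cabs g.
    apply: (le_trans (cabsD _ _)); rewrite cabsM cabs_toC // lerD2r.
    by apply: (le_trans (cabsD _ _)); rewrite !cabsM !cabs_conj.
  have := sqr_ge0 (cabs x00 - cabs x11); lra.
have hh : 0 <= 1 / 2 - h by lra.
have nn (u v : C) : 0 <= (u + v) * (u + v)^*%R by rewrite mul_conjC_ge0.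
have := addr_ge0 (mulr_ge0 (_ : 0 <= toC h) key)
  (mulr_ge0 (_ : 0 <= toC (1 / 2 - h)) (addr_ge0 (nn x00 x11) (nn x10 x01))).
rewrite !toC_ge0 => /(_ h0 hh); congr (0 <= _); rewrite /z.
rewrite (_ : toC (2 * _ + _) = 2 * (toC (cabs x00 ^+ 2) + toC (cabs x11 ^+ 2)) +
  (toC P * toC B0 + toC Q * toC B1)); last by ring.
rewrite (_ : toC ((1 / 2 + h) * _ + _ + _) =
  toC (1 / 2 + h) * (toC (cabs x00 ^+ 2) + toC (cabs x11 ^+ 2)) +
  toC (1 / 2 - h) * (toC (cabs x10 ^+ 2) + toC (cabs x01 ^+ 2)) +
  toC h * (toC P * toC B0 + toC Q * toC B1)); last by ring.
rewrite !sqr_cabs !(rmorphD Num.conj, rmorphM Num.conj) /= !conjCK !conj_toC.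
rewrite [toC (1 / 2 + h)]rmorphD [toC (1 / 2 - h)]rmorphB /=.
by move: (toC (1 / 2)) => c; ring.
Qed.

Lemma psdmx1 n : psdmx (1%:M : 'M[C]_n).
Proof.
move=> v; rewrite mulmx1 mxE sumr_ge0 // => i _.
by rewrite adjmxE mulrC mul_conjC_ge0.
Qed.

(** V = D + H is Hermitian with V ^ 2 = 2 D V, hence 1 / (2 D) times a congruence of the
    identity. *)
Lemma psdmx_sqr_scalar n (H : 'M[C]_n) (D : R) : 0 < D -> H^t* = H ->
  H *m H = (toC D ^+ 2)%:M -> psdmx ((toC D)%:M + H).
Proof.
move=> D0 hH HH; set V := _ + H.
have Vh : V^t* = V.
  by rewrite /V adjmxD hH tr_scalar_mx map_scalar_mx /= conj_toC.
have -> : V = (2 * toC D)^-1 *: (V *m 1%:M *m V^t*).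
  have DN : 2 * toC D != 0.
    by rewrite mulf_neq0 ?pnatr_eq0 // fmorph_eq0 gt_eqF.
  have VV : V *m V = (2 * toC D) *: V.
    rewrite /V mulmxDr !mulmxDl HH -!scalar_mxM !mul_scalar_mx mul_mx_scalar.
    by apply/matrixP=> i j; rewrite mxZE !mxDE !mxZE !mxE; ring.
  by rewrite mulmx1 Vh VV scalerA mulVf // scale1r.
apply: psdmxZ; first by rewrite invr_ge0 mulr_ge0 // toC_ge0 ltW.
exact/psdmx_congr/psdmx1.
Qed.

(* T (x) 1 + Y (x) H is the mean of (T +- D Y) (x) (1 +- H / D), and the spectrum of H is
   contained in {D, - D}. *)
Lemma tens_sub_add_separable m n (T Y : 'M[C]_m) (H : 'M[C]_n) (D : R) : 0 < D ->
  H^t* = H -> H *m H = (toC D ^+ 2)%:M ->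
  psdmx (T + toC D *: Y) -> psdmx (T - toC D *: Y) ->
  sepcone (tensmx T 1%:M + tensmx Y H).
Proof.
move=> D0 hH HH hp hm.
have DN : toC D != 0 by rewrite fmorph_eq0 gt_eqF.
have -> : tensmx T 1%:M + tensmx Y H = (2 * toC D)^-1 *:
   (tensmx (T + toC D *: Y) ((toC D)%:M + H) + tensmx (T - toC D *: Y) ((toC D)%:M - H)).
  apply/matrixP=> u v; case: (mxtens_indexP u) => i k; case: (mxtens_indexP v) => j l.
  rewrite mxZE !mxDE !tensmxE !mxDE.
  by rewrite [(- (_ *: Y)) _ _]mxE [(- H) _ _]mxE !mxZE ![_%:M _ _]mxE; case: (k == l) => /=; field.
apply: sepconeZ; first by rewrite invr_ge0 mulr_ge0 // toC_ge0 ltW.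
apply: SepconeD; apply: SepconeT => //; first exact: psdmx_sqr_scalar.
apply: psdmx_sqr_scalar => //; first by rewrite -scaleN1r adjmxZ hH rmorphN rmorph1.
by rewrite mulNmx mulmxN opprK.
Qed.

Lemma eq_bmx (A A' B B' D D' E E' : 'M[C]_2) : A = A' -> B = B' -> D = D' -> E = E' ->
  bmx A B D E = bmx A' B' D' E'.
Proof. by move=> -> -> -> ->. Qed.

Lemma bmxD A B B' D X Y Y' Z : bmx A B B' D + bmx X Y Y' Z =
  bmx (A + X) (B + Y) (B' + Y') (D + Z) :> 'M[C]_(2 * 2).
Proof.
rewrite /bmx !tensmxDr; apply/matrixP=> u v; rewrite !mxDE; ring.
Qed.

Lemma bmxZ c A B B' D : c *: bmx A B B' D =
  bmx (c *: A) (c *: B) (c *: B') (c *: D) :> 'M[C]_(2 * 2).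
Proof. by rewrite /bmx !scalerDr -!tensmxZr. Qed.

(** The left factors are the images of the matrix units under [pauli_op], with a = l0 + l3, d = l0 -
    l3, b = l1 + l2, c = l1 - l2. *)
Lemma sum_tens_mat2 (a b c d : C) (X1 X2 X3 X4 : 'M[C]_2) :
  tensmx (mat2 a 0 0 d) X1 + tensmx (mat2 0 b c 0) X2 +
  (tensmx (mat2 0 c b 0) X3 + tensmx (mat2 d 0 0 a) X4) =
  bmx (a *: X1 + d *: X4) (b *: X2 + c *: X3) (c *: X2 + b *: X3) (d *: X1 + a *: X4).
Proof.
apply/matrixP=> u v; case: (mxtens_indexP u) => i k; case: (mxtens_indexP v) => j l.
rewrite bmxE 3!mxDE 4!tensmxE 4!mxDE 8!mxZE.
by move: i j; do 2![apply: ord2P]; rewrite !mat2E /=; ring.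
Qed.

Lemma mulmx_adj_eq0 m n (A : 'M[C]_(m, n)) : A *m A^t* = 0 -> A = 0.
Proof.
move=> h; apply/matrixP=> i j; rewrite [RHS]mxE.
have := congr1 (fun Z : 'M[C]_m => Z i i) h; rewrite !mxE => /eqP.
rewrite psumr_eq0 => [/allP/(_ j (mem_index_enum _))|k _]; rewrite adjmxE.
  by rewrite mul_conjC_eq0 => /eqP.
exact: mul_conjC_ge0.
Qed.

(** W = outer a0 a1 - outer a1 a0 is anti-Hermitian, and traceless because <a0, a1> is real. Hence H
    = - 'i W satisfies H ^ 2 = D ^ 2 with D the modulus of det (a0, a1), and the matrix is T (x) 1 +
    Y (x) H with Y = - sigma_2. The off-diagonal entries of T +- D Y have squared modulus t ^ 2 + D
    ^ 2 = |a0| ^ 2 |a1| ^ 2 <= P Q. *)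
Lemma cross_separable (a0 a1 : 'cV[C]_2) (t P Q : R) : dot a0 a1 = toC t ->
  0 <= P -> 0 <= Q -> sqn a0 * sqn a1 <= P * Q ->
  sepcone (bmx (toC P)%:M ((toC t)%:M + (outer a0 a1 - outer a1 a0))
    ((toC t)%:M + (outer a1 a0 - outer a0 a1)) (toC Q)%:M).
Proof.
move=> ht P0 Q0 hPQ; have ii : 'i * 'i = -1 :> C by rewrite -expr2 sqrCi.
pose D := cabs (det2 a0 a1).
have DE : D ^+ 2 + t ^+ 2 = sqn a0 * sqn a1.
  rewrite -lagrange; congr (_ + _); apply: toCI.
  by rewrite sqr_cabs ht conj_toC rmorphXn expr2.
pose W := outer a0 a1 - outer a1 a0; pose H := - 'i *: W.
pose T := mat2 (toC P) (toC t) (toC t) (toC Q); pose Y : 'M[C]_2 := mat2 0 'i (- 'i) 0.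
have -> : bmx (toC P)%:M ((toC t)%:M + W) ((toC t)%:M + (outer a1 a0 - outer a0 a1))
    (toC Q)%:M = tensmx T 1%:M + tensmx Y H.
  have WN : outer a1 a0 - outer a0 a1 = - W by rewrite opprB.
  have WE : W = 'i *: H by rewrite scalerA mulrN ii opprK scale1r.
  rewrite WN WE; apply/matrixP=> u v.
  case: (mxtens_indexP u) => i k; case: (mxtens_indexP v) => j l.
  rewrite bmxE [RHS]mxDE !tensmxE !mxDE [(- (_ *: H)) _ _]mxE mxZE ![_%:M _ _]mxE.
  move: (H k l) => x; move: i j.
  by do 2![apply: ord2P]; rewrite !mat2E /=; case: (k == l) => /=; ring.
have Hh : H^t* = H.
  apply/matrixP=> i j; rewrite adjmxE !mxZE /W !mxDE [(- outer a1 a0) _ _]mxE.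
  rewrite [(- outer a1 a0) _ _]mxE !outerE !(rmorphB, rmorphM, rmorphN) /= conjCi !conjCK; ring.
have hT s : s ^+ 2 = 1 -> psdmx (T + (toC (s * D)) *: Y).
  move=> s1.
  have -> : T + toC (s * D) *: Y = mat2 (toC P) (toC t + toC (s * D) * 'i)
      (toC t + toC (s * D) * 'i)^*%R (toC Q).
    apply: matrix2P; rewrite mxDE mxZE !mat2E ?rmorphD ?rmorphM /= ?conjCi ?conj_toC; ring.
  apply: psdmx_mat2 => //; rewrite (le_trans _ hPQ) // -DE le_eqVlt; apply/orP; left.
  apply/eqP/toCI; rewrite sqr_cabs !rmorphD !rmorphM /= conjCi !conj_toC.
  have s1' : toC s * toC s = 1 by rewrite -rmorphM -expr2 s1 rmorph1.
  transitivity (toC t * toC t - toC s * toC s * ('i * 'i) * (toC D * toC D)); first by ring.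
  by rewrite s1' ii; ring.
have WE i j : W i j = a0 i 0 * (a1 j 0)^*%R - a1 i 0 * (a0 j 0)^*%R.
  by rewrite /W mxDE [(- outer a1 a0) _ _]mxE !outerE.
have W11 : W 1 1 = - W 0 0.
  have := conj_toC t; rewrite -ht -dotC /dot !WE => /eqP.
  rewrite -subr_eq0 => /eqP h; apply/eqP; rewrite -subr_eq0 -h; apply/eqP; ring.
have detW : W 0 0 * W 0 0 + W 0 1 * W 1 0 = - toC D ^+ 2.
  rewrite -{2}[W 0 0]opprK -W11 -rmorphXn sqr_cabs !WE /det2.
  by rewrite !(rmorphB, rmorphM) /=; ring.
have WW : W *m W = (- toC D ^+ 2)%:M.
  apply: matrix2P; rewrite mulmx2E [RHS]mxE ?W11 /= -?detW; ring.
have HH : H *m H = (toC D ^+ 2)%:M.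
  by rewrite -scalemxAl -scalemxAr scalerA mulrNN ii WW scale_scalar_mx mulN1r opprK.
(* [tens_sub_add_separable] divides by [D]; for parallel vectors H has square 0 and, being
   Hermitian, vanishes. *)
have [D0|D0] := leP D 0.
  have D00 : D = 0 by apply/eqP; rewrite eq_le D0 cabs_ge0.
  have -> : H = 0.
    by apply: mulmx_adj_eq0; rewrite Hh HH D00 rmorph0 expr0n raddf0.
  rewrite tensmx0 addr0; apply: SepconeT; last exact: psdmx1.
  have := hT 1 (expr1n _ _); rewrite D00 mulr0 rmorph0 scale0r addr0; exact.
apply: (@tens_sub_add_separable _ _ _ _ _ D) => //.
  by have := hT 1 (expr1n _ _); rewrite mul1r.
by have := hT (-1); rewrite sqrrN expr1n mulN1r rmorphN scaleNr; apply.
Qed.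

(** Conjugation by the unitary diag(1, conj w) on the first factor. *)
Lemma sepcone_phase w (A B B' D : 'M[C]_2) : w * w^*%R = 1 ->
  sepcone (bmx A (w^*%R *: B) (w *: B') D) -> sepcone (bmx A B B' D).
Proof.
move=> w1 /(sepcone_conj (mat2 1 0 0 w^*%R) 1%:M).
have E i j : conjmap (mat2 1 0 0 w^*%R) (delta_mx i j) =
    ((if i == 1 then w^*%R else 1) * (if j == 1 then w else 1)) *: delta_mx i j.
  apply: matrix2P; rewrite mxZE /conjmap 3?mulmx2E 2!adjmxE 5?mat2E ?rmorph0 ?rmorph1 ?conjCK;
  rewrite !mxE /=; move: i j; do 2![apply: ord2P] => /=; ring.
rewrite /bmx 3!conjmapD 4!conjmap_tens 4!conjmap1 4!E /=.
by rewrite !mul1r !mulr1 scale1r mulrC w1 scale1r !tensmxZl !tensmxZr !scalerA w1 mulrC w1 !scale1r.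
Qed.

Lemma dotZr a w b : dot a (w *: b) = w * dot a b.
Proof. by rewrite /dot !mxZE; ring. Qed.

Lemma dotZl a w b : dot (w *: a) b = w^*%R * dot a b.
Proof. by rewrite dotC dotZr rmorphM /= -dotC. Qed.

Lemma outerZ a b u v : outer (u *: a) (v *: b) = (u * v^*%R) *: outer a b.
Proof. by apply/matrixP=> i j; rewrite mxZE !outerE !mxZE rmorphM /=; ring. Qed.

Lemma isoopZ y a b u v : isoop y (u *: a) (v *: b) = (u * v^*%R) *: isoop y a b.
Proof.
rewrite /isoop outerZ dotZl dotZr scalerDr !scalerA mulrC -scale_scalar_mx; congr (_ + _).
by apply/matrixP=> i j; rewrite !mxE; ring.
Qed.

(** The mean of outer a0 a1 and outer a1 a0 goes into a matrix with equal off-diagonal blocks, their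
    difference into one for [cross_separable]. The scalar part 2 (1 + y) P of the first diagonal
    block is shared as 2 y P and 2 P, likewise for Q, so that both summands are psd. *)
Lemma depolarized_separable_real (y t : R) (a0 a1 : 'cV[C]_2) : 0 <= y <= 1 -> 0 <= t ->
  dot a0 a1 = toC t ->
  sepcone (bmx
    (toC (1 + y) *: isoop (1 + y) a0 a0 + toC (1 - y) *: isoop (1 + y) a1 a1)
    (2 *: isoop (1 + y) a0 a1) (2 *: isoop (1 + y) a1 a0)
    (toC (1 - y) *: isoop (1 + y) a0 a0 + toC (1 + y) *: isoop (1 + y) a1 a1)).
Proof.
move=> /andP[y0 y1] t0 ht.
pose h := y / 2; pose p := 1 / 2 + h; pose q := 1 / 2 - h.
have h0 : 0 <= h by rewrite /h; lra.
have h1 : 2 * h <= 1 by rewrite /h; lra.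
have yE : y = 2 * h by rewrite /h; lra.
pose P := p * sqn a0 + q * sqn a1; pose Q := q * sqn a0 + p * sqn a1.
have p0 : 0 <= p by rewrite /p; lra.
have q0 : 0 <= q by rewrite /q; lra.
have P0 : 0 <= P by rewrite addr_ge0 ?mulr_ge0 ?sqn_ge0.
have Q0 : 0 <= Q by rewrite addr_ge0 ?mulr_ge0 ?sqn_ge0.
have PQ : sqn a0 * sqn a1 <= P * Q.
  rewrite -subr_ge0 (_ : _ - _ = p * q * (sqn a0 - sqn a1) ^+ 2).
    by rewrite mulr_ge0 ?sqr_ge0 // mulr_ge0.
  by rewrite /P /Q /p /q; field.
pose A1 := toC p *: outer a0 a0 + toC q *: outer a1 a1 + (toC (h * P))%:M.
pose D1 := toC q *: outer a0 a0 + toC p *: outer a1 a1 + (toC (h * Q))%:M.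
pose B1 := toC (1 / 2) *: (outer a0 a1 + outer a1 a0) + (toC (h * t))%:M.
have S1 : sepcone (bmx A1 B1 B1 D1).
  apply: rebit_separable; apply/psdmx_bmxP => b0 b1.
  rewrite 6!form_add 6!form_scale 2!form_add 4!form_scalar 8!form_outer.
  have hN : cabs (det2 a0 a1) ^+ 2 + t ^+ 2 <= P * Q.
    by rewrite (le_trans _ PQ) // -lagrange ht cabs_toC.
  have := @depolarized_bound h (dot a0 b0) (dot a1 b1) (dot a1 b0) (dot a0 b1)
    (dot b0 b1) (cabs (det2 a0 a1)) (cabs (det2 b0 b1)) t (sqn b0) (sqn b1) P Q
    h0 h1 P0 Q0 (sqn_ge0 b0) (sqn_ge0 b1) t0 (cabs_dot_cross _ _ _ _) hN (lagrange b0 b1).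
  congr (0 <= _); rewrite (dotC b0 b1) !dot_self -/p -/q.
  clearbody p q P Q; rewrite (_ : toC (p * _ + _ + _) = toC p * (toC (cabs (dot a0 b0) ^+ 2) +
    toC (cabs (dot a1 b1) ^+ 2)) + toC q * (toC (cabs (dot a1 b0) ^+ 2) +
    toC (cabs (dot a0 b1) ^+ 2)) + toC h * (toC P * toC (sqn b0) + toC Q * toC (sqn b1)));
    last by ring.
  rewrite !sqr_cabs [toC (h * P)]rmorphM [toC (h * Q)]rmorphM /=.
  move: (toC p) (toC q) (toC P) (toC Q) (toC (sqn b0)) (toC (sqn b1))
    => p' q' P' Q' n0 n1.
  move: (dot a0 b0) (dot a1 b1) (dot a1 b0) (dot a0 b1) (dot b0 b1) => x00 x11 x10 x01 g.
  by rewrite !(rmorphD Num.conj, rmorphM Num.conj) /= !conjCK !conj_toC; ring.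
have S2 := cross_separable ht P0 Q0 PQ.
suff -> : bmx (toC (1 + y) *: isoop (1 + y) a0 a0 + toC (1 - y) *: isoop (1 + y) a1 a1)
    (2 *: isoop (1 + y) a0 a1) (2 *: isoop (1 + y) a1 a0)
    (toC (1 - y) *: isoop (1 + y) a0 a0 + toC (1 + y) *: isoop (1 + y) a1 a1) =
    4 *: bmx A1 B1 B1 D1 + 2 *: bmx (toC P)%:M ((toC t)%:M + (outer a0 a1 - outer a1 a0))
      ((toC t)%:M + (outer a1 a0 - outer a0 a1)) (toC Q)%:M.
  by apply: SepconeD; apply: sepconeZ.
rewrite !bmxZ bmxD /isoop [dot a1 a0]dotC ht conj_toC !dot_self.
have c2 : toC (1 / 2) = 1 / 2 by rewrite rmorphM rmorph1 fmorphV rmorph_nat.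
have sE (c : C) i j : (c%:M : 'M[C]_2) i j = c * (i == j)%:R.
  by rewrite mxE; case: (i == j); rewrite ?mulr1 ?mulr0.
have A1E i j : A1 i j = toC p * outer a0 a0 i j + toC q * outer a1 a1 i j
    + toC (h * P) * (i == j)%:R by rewrite 2!mxDE 2!mxZE sE.
have D1E i j : D1 i j = toC q * outer a0 a0 i j + toC p * outer a1 a1 i j
    + toC (h * Q) * (i == j)%:R by rewrite 2!mxDE 2!mxZE sE.
have B1E i j : B1 i j = toC (1 / 2) * (outer a0 a1 i j + outer a1 a0 i j)
    + toC (h * t) * (i == j)%:R by rewrite mxDE mxZE mxDE sE.
have WE (a b : 'cV[C]_2) i j : ((toC t)%:M + (outer a b - outer b a)) i j =
    toC t * (i == j)%:R + (outer a b i j - outer b a i j).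
  by rewrite 2!mxDE sE [(- outer b a) i j]mxE.
have pE : toC p = 1 / 2 + toC h by rewrite rmorphD c2.
have qE : toC q = 1 / 2 - toC h by rewrite rmorphB c2.
have TE : toC (1 + y) = 1 + 2 * toC h.
  by rewrite yE rmorphD rmorph1 rmorphM rmorph_nat.
have SE : toC (1 - y) = 1 - 2 * toC h.
  by rewrite yE rmorphB rmorph1 rmorphM rmorph_nat.
have PE : toC P = (1 / 2 + toC h) * toC (sqn a0) + (1 / 2 - toC h) * toC (sqn a1).
  by rewrite -pE -qE -!rmorphM -rmorphD.
have QE : toC Q = (1 / 2 - toC h) * toC (sqn a0) + (1 / 2 + toC h) * toC (sqn a1).
  by rewrite -pE -qE -!rmorphM -rmorphD.
have hP := rmorphM toC h P; have hQ := rmorphM toC h Q; have hht := rmorphM toC h t.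
clearbody A1 B1 D1 p q P Q h.
apply: eq_bmx.
- apply/matrixP=> i j; rewrite [LHS]mxDE [RHS]mxDE 4!mxZE A1E 2!mxDE 3!sE 2!mxZE hP.
  by rewrite /= PE pE qE TE SE; field.
- apply/matrixP=> i j; rewrite [LHS]mxZE [RHS]mxDE 2!mxZE B1E WE mxDE mxZE sE hht.
  by rewrite /= TE c2; field.
- apply/matrixP=> i j; rewrite [LHS]mxZE [RHS]mxDE 2!mxZE B1E WE mxDE mxZE sE hht.
  by rewrite /= TE c2; field.
apply/matrixP=> i j; rewrite [LHS]mxDE [RHS]mxDE 4!mxZE D1E 2!mxDE 3!sE 2!mxZE hQ.
by rewrite /= QE pE qE TE SE; field.
Qed.

(* A phase on a1 makes <a0, a1> real and nonnegative. *)
Lemma depolarized_separable (y : R) (a0 a1 : 'cV[C]_2) : 0 <= y <= 1 ->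
  sepcone (bmx
    (toC (1 + y) *: isoop (1 + y) a0 a0 + toC (1 - y) *: isoop (1 + y) a1 a1)
    (2 *: isoop (1 + y) a0 a1) (2 *: isoop (1 + y) a1 a0)
    (toC (1 - y) *: isoop (1 + y) a0 a0 + toC (1 + y) *: isoop (1 + y) a1 a1)).
Proof.
move=> y01; have [w w1 wt] : exists2 w : C, w * w^*%R = 1 & w * dot a0 a1 = toC (cabs (dot a0 a1)).
  have [->|g0] := eqVneq (dot a0 a1) 0.
    by exists 1; rewrite ?rmorph1 ?mulr1 // mulr0 cabsE normr0.
  have n0 : `|dot a0 a1| != 0 by rewrite normr_eq0.
  have nn : `|dot a0 a1| \is Num.real by rewrite normr_real.
  rewrite cabsE; move: (dot a0 a1) n0 nn => g n0 nn; exists (g^*%R / `|g|).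
    rewrite (rmorphM Num.conj) (fmorphV Num.conj) /= conjCK (conj_Creal nn).
    by rewrite mulf_div -expr2 [X in X / _]mulrC -normCK divff // expf_neq0.
  by rewrite mulrAC [X in X / _]mulrC -normCK expr2 mulfK.
have w1' : w^*%R * w = 1 by rewrite mulrC.
apply: (sepcone_phase w1).
have := @depolarized_separable_real y _ a0 (w *: a1) y01 (cabs_ge0 (dot a0 a1)).
rewrite dotZr wt => /(_ erefl).
rewrite isoopZ w1 scale1r -[X in isoop _ X (w *: a1)]scale1r -[X in isoop _ (w *: a1) X]scale1r.
by rewrite !isoopZ rmorph1 mul1r mulr1 !scalerA ![2 * _]mulrC.
Qed.

(* The four combinations x0 = p + t, x1 = q + s, x2 = q - s, x3 = p - t satisfy
   x2 ^ 2 = x1 ^ 2 + x3 ^ 2 - x0 ^ 2. *)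
Lemma isotropic_bound (p q s t : C) : p * t = q * s ->
  0 <= (p + t) * (p + t)^*%R + (q + s) * (q + s)^*%R + (p - t) * (p - t)^*%R
    - (q - s) * (q - s)^*%R.
Proof.
move=> h; rewrite -!normCK subr_ge0 -!normrX.
have -> : (q - s) ^+ 2 = - (p + t) ^+ 2 + (q + s) ^+ 2 + (p - t) ^+ 2.
  have -> : (q - s) ^+ 2 = (q + s) ^+ 2 - 4 * (q * s) by ring.
  by rewrite -h; ring.
apply: (le_trans (ler_normD _ _)); rewrite lerD2r; apply: (le_trans (ler_normD _ _)).
by rewrite normrN.
Qed.

(** The form <x, G z> with G = [[1, y], [y, 1]], the entrywise multiplier of phase damping. *)
Definition gram (y x0 x1 z0 z1 : C) : C :=
  x0^*%R * z0 + x1^*%R * z1 + y * (x0^*%R * z1 + x1^*%R * z0).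

(** In the combinations x0, ..., x3 of [isotropic_bound], and with G(x) for [gram] at (x, x), twice
    the form is (3 + y) G(x0) + (1 + y) (G(x1) + G(x3)) - (1 - y) G(x2). Expand G(x2) as 1 + y times
    the squared moduli minus y times the squared difference, the others as 1 - y times the squared
    moduli plus y times the squared sum; [isotropic_bound] compensates the negative terms. *)
Lemma gram_bound (y p0 q0 s0 t0 p1 q1 s1 t1 : C) : 0 <= y <= 1 ->
  p0 * t0 = q0 * s0 -> p1 * t1 = q1 * s1 ->
  0 <= (2 + y) * gram y p0 p1 p0 p1 + y * gram y q0 q1 q0 q1
     + (gram y p0 p1 t0 t1 + gram y q0 q1 s0 s1)
     + (gram y s0 s1 q0 q1 + gram y t0 t1 p0 p1)
     + (y * gram y s0 s1 s0 s1 + (2 + y) * gram y t0 t1 t0 t1).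
Proof.
move=> /andP[y0 y1] h0 h1; have n2 : 2 != 0 :> C by rewrite pnatr_eq0.
rewrite -[X in _ <= X](mulKf n2).
have nn (u : C) : 0 <= u * u^*%R by rewrite mul_conjC_ge0.
have y1' : 0 <= 1 - y by rewrite subr_ge0.
have key : 0 <= (1 - y) * (1 + y) *
   (((p0 + t0) * (p0 + t0)^*%R + (q0 + s0) * (q0 + s0)^*%R + (p0 - t0) * (p0 - t0)^*%R
      - (q0 - s0) * (q0 - s0)^*%R) +
    ((p1 + t1) * (p1 + t1)^*%R + (q1 + s1) * (q1 + s1)^*%R + (p1 - t1) * (p1 - t1)^*%R
      - (q1 - s1) * (q1 - s1)^*%R)) +
   2 * (1 - y) * ((p0 + t0) * (p0 + t0)^*%R + (p1 + t1) * (p1 + t1)^*%R) +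
   y * ((3 + y) * ((p0 + t0 + (p1 + t1)) * (p0 + t0 + (p1 + t1))^*%R) +
     (1 + y) * ((q0 + s0 + (q1 + s1)) * (q0 + s0 + (q1 + s1))^*%R +
       (p0 - t0 + (p1 - t1)) * (p0 - t0 + (p1 - t1))^*%R) +
     (1 - y) * ((q0 - s0 - (q1 - s1)) * (q0 - s0 - (q1 - s1))^*%R)).
  have c1 : 0 <= 1 + y by rewrite addr_ge0.
  have c3 : 0 <= 3 + y by rewrite addr_ge0.
  have i0 := isotropic_bound h0; have i1 := isotropic_bound h1.
  by repeat first [assumption | exact: ler0n | exact: nn | apply: addr_ge0 | apply: mulr_ge0].
rewrite mulr_ge0 ?invr_ge0 //; move: key; congr (0 <= _); rewrite /gram.
by rewrite !(rmorphD Num.conj, rmorphB Num.conj) /=; ring.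
Qed.

Definition damp (y : C) (a b : 'cV[C]_2) : 'M[C]_2 :=
  mat2 (2 * outer a b 0 0) (2 * y * outer a b 0 1)
       (2 * y * outer a b 1 0) (2 * outer a b 1 1).

Lemma form_damp y (a b u v : 'cV[C]_2) : (u^t* *m damp y a b *m v) 0 0 =
  2 * gram y ((a 0 0)^*%R * u 0 0) ((a 1 0)^*%R * u 1 0)
         ((b 0 0)^*%R * v 0 0) ((b 1 0)^*%R * v 1 0).
Proof. by rewrite form2E !mat2E !outerE /gram !(rmorphM Num.conj) /= !conjCK; ring. Qed.

(** For each coordinate k the four products of conj(a_i k) and b_j k form a table of rank one, which
    is the hypothesis p t = q s of [gram_bound]. *)
Lemma damp_separable y a0 a1 : 0 <= y <= 1 ->
  sepcone (bmx ((2 + y) *: damp y a0 a0 + y *: damp y a1 a1)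
    (damp y a0 a1 + damp y a1 a0) (damp y a0 a1 + damp y a1 a0)
    (y *: damp y a0 a0 + (2 + y) *: damp y a1 a1)).
Proof.
move=> y01; apply: rebit_separable; apply/psdmx_bmxP => b0 b1.
rewrite 4!form_add 4!form_scale 8!form_damp.
have := @gram_bound y ((a0 0 0)^*%R * b0 0 0) ((a1 0 0)^*%R * b0 0 0) ((a0 0 0)^*%R * b1 0 0)
 ((a1 0 0)^*%R * b1 0 0) ((a0 1 0)^*%R * b0 1 0) ((a1 1 0)^*%R * b0 1 0)
 ((a0 1 0)^*%R * b1 1 0) ((a1 1 0)^*%R * b1 1 0) y01 _ _.
move=> /(_ _)/(_ _)/(mulr_ge0 (ler0n C 2)) h.
apply: le_trans (h _ _) _; [ring|ring|rewrite le_eqVlt; apply/orP; left; apply/eqP].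
move: (gram _ _ _ _ _) (gram _ _ _ _ _) (gram _ _ _ _ _) (gram _ _ _ _ _)
  (gram _ _ _ _ _) (gram _ _ _ _ _) (gram _ _ _ _ _) (gram _ _ _ _ _) => *.
ring.
Qed.
End Families.

(** * Tensor products of maps, local congruences, exchange of the factors *)

Section LocalMaps.
Variable R : realType.
Local Notation C := R[i].

Lemma psdE n (A : 'M[C]_n) : psd A <-> psdmx A.
Proof. by []. Qed.

Lemma eq_tensor_map m n p q (f f' : {linear 'M[C]_m -> 'M[C]_p})
    (g g' : {linear 'M[C]_n -> 'M[C]_q}) Z :
  f =1 f' -> g =1 g' -> tensor_map f g Z = tensor_map f' g' Z.
Proof.
move=> ef eg; rewrite /tensor_map.
by do 4![apply: eq_bigr => ? _]; rewrite ef eg.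
Qed.

Lemma tensor_map_comp m n p q r s
    (f' : {linear 'M[C]_p -> 'M[C]_r}) (f : {linear 'M[C]_m -> 'M[C]_p})
    (g' : {linear 'M[C]_q -> 'M[C]_s}) (g : {linear 'M[C]_n -> 'M[C]_q}) Z :
  tensor_map f' g' (tensor_map f g Z) = tensor_map (f' \o f) (g' \o g) Z.
Proof.
rewrite {2}/tensor_map /= linear_sum; apply: eq_bigr => i _.
rewrite linear_sum; apply: eq_bigr => j _; rewrite linear_sum; apply: eq_bigr => k _.
by rewrite linear_sum; apply: eq_bigr => l _; rewrite linearZ /= tensor_map_tens.
Qed.

Lemma sepcone_tensor_map m n p q (f : {linear 'M[C]_m -> 'M[C]_p})
    (g : {linear 'M[C]_n -> 'M[C]_q}) X :
  positive_map f -> positive_map g -> sepcone X -> sepcone (tensor_map f g X).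
Proof.
move=> hf hg; elim=> [|A B hA hB|Y Z _ hY _ hZ].
- by rewrite linear0; exact: Sepcone0.
- by rewrite tensor_map_tens; apply: SepconeT; [apply: hf|apply: hg].
- by rewrite linearD; apply: SepconeD.
Qed.

Lemma conjmap_is_linear m n (V : 'M[C]_(m, n)) : linear (conjmap V).
Proof.
by move=> a X Y; rewrite /conjmap mulmxDr mulmxDl -scalemxAr -scalemxAl.
Qed.

HB.instance Definition _ m n (V : 'M[C]_(m, n)) :=
  GRing.isLinear.Build C 'M[C]_n 'M[C]_m _ (conjmap V) (conjmap_is_linear V).

Lemma positive_conjmap m n (V : 'M[C]_(m, n)) : positive_map (conjmap V).
Proof. by move=> X hX; apply: psdmx_congr. Qed.

Lemma positive_trmx n : positive_map (@trmx C n n : {linear _ -> _}).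
Proof. exact: psdmx_trmx. Qed.

Lemma linear_tens_ext m n (V : lmodType C) (F G : {linear 'M[C]_(m * n) -> V}) :
  (forall A B, F (tensmx A B) = G (tensmx A B)) -> F =1 G.
Proof.
move=> FG Z; rewrite (matrix_sum_block Z) !linear_sum; apply: eq_bigr => i _.
by rewrite !linear_sum; apply: eq_bigr => j _; apply: FG.
Qed.

Lemma tensor_map_block m n p q (f : {linear 'M[C]_m -> 'M[C]_p})
    (g : {linear 'M[C]_n -> 'M[C]_q}) Z :
  tensor_map f g Z = \sum_i \sum_j tensmx (f (delta_mx i j)) (g (block Z i j)).
Proof.
rewrite [in LHS](matrix_sum_block Z) linear_sum; apply: eq_bigr => i _.
by rewrite linear_sum; apply: eq_bigr => j _; rewrite /= tensor_map_tens.
Qed.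

Lemma tensor_map_conj m n p q (V : 'M[C]_(p, m)) (W : 'M[C]_(q, n)) Z :
  tensor_map (conjmap V) (conjmap W) Z = conjmap (tensmx V W) Z.
Proof.
rewrite tensor_map_block [in RHS](matrix_sum_block Z) linear_sum; apply: eq_bigr => i _.
rewrite linear_sum; apply: eq_bigr => j _.
by rewrite /= /conjmap adjmx_tens !tensmx_mul.
Qed.

Definition swapmx m n (Z : 'M[C]_(m * n)) : 'M[C]_(n * m) :=
  \matrix_(u, v) Z (mxtens_index ((mxtens_unindex u).2, (mxtens_unindex u).1))
                   (mxtens_index ((mxtens_unindex v).2, (mxtens_unindex v).1)).

Lemma swapmx_tens m n (A : 'M[C]_m) (B : 'M[C]_n) :
  swapmx (tensmx A B) = tensmx B A.
Proof. by apply/matrixP=> u v; rewrite mxE tensmxE mxE mulrC. Qed.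

Lemma swapmxK m n (Z : 'M[C]_(m * n)) : swapmx (swapmx Z) = Z.
Proof.
apply/matrixP=> u v; case: (mxtens_indexP u) => i k; case: (mxtens_indexP v) => j l.
by rewrite !mxE !mxtens_indexK.
Qed.

Lemma swapmx_is_linear m n : linear (@swapmx m n).
Proof. by move=> a X Y; apply/matrixP=> u v; rewrite !mxE. Qed.

HB.instance Definition _ m n :=
  GRing.isLinear.Build C 'M[C]_(m * n) 'M[C]_(n * m) _ (@swapmx m n)
    (@swapmx_is_linear m n).

Lemma tensor_map_swap m n p q (f : {linear 'M[C]_m -> 'M[C]_p})
    (g : {linear 'M[C]_n -> 'M[C]_q}) Z :
  swapmx (tensor_map f g Z) = tensor_map g f (swapmx Z).
Proof.
pose F : {linear _ -> _} := @swapmx p q \o tensor_map f g.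
pose G : {linear _ -> _} := tensor_map g f \o @swapmx m n.
rewrite -[LHS]/(F Z) -[RHS]/(G Z); apply: linear_tens_ext => A B.
by rewrite /F /G /= tensor_map_tens !swapmx_tens tensor_map_tens.
Qed.

Lemma sepcone_swap m n (Z : 'M[C]_(m * n)) : sepcone Z -> sepcone (swapmx Z).
Proof.
elim=> [|A B hA hB|X Y _ hX _ hY].
- by rewrite linear0; exact: Sepcone0.
- by rewrite swapmx_tens; exact: SepconeT.
- by rewrite linearD; exact: SepconeD.
Qed.

Lemma psd_swap m n (Z : 'M[C]_(m * n)) : psd Z -> psd (swapmx Z).
Proof.
move=> /psdmx_sum_rank1[v ->]; rewrite linear_sum; apply: psdmx_sum => i _ /=.
pose w : 'cV[C]_(n * m) :=
  \col_u v i (mxtens_index ((mxtens_unindex u).2, (mxtens_unindex u).1)) 0.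
suff -> : swapmx (v i *m (v i)^t*) = w *m w^t* by apply: psdmx_rank1.
by apply/matrixP=> a b; rewrite !mxE !big_ord1 !mxE.
Qed.

End LocalMaps.

(** * From the separable cone to mixtures of product states *)

Section Mixtures.
Variable R : realType.
Local Notation C := R[i].

(** A psd matrix of trace 0 is 0, so the arbitrary state chosen for it enters a mixture with weight
    0. *)
Definition normalize (A : 'M[C]_2) : 'M[C]_2 :=
  if \tr A == 0 then delta_mx 0 0 else (\tr A)^-1 *: A.

Lemma density_normalize (A : 'M[C]_2) : psd A -> density (normalize A).
Proof.
rewrite /normalize => hA; case: eqP => [_|/eqP h].
  split; last by rewrite /mxtrace !big_ord_recl big_ord0 !mxE /= !addr0.
  have -> : delta_mx 0 0 = (delta_mx 0 0 : 'cV[C]_2) *m (delta_mx 0 0 : 'cV[C]_2)^t*.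
    apply/matrixP=> i j; rewrite !mxE big_ord1 !mxE !eqxx !andbT.
    by case: eqP; case: eqP => /= _ _; rewrite ?conjC1 ?conjC0 ?mulr1 ?mulr0 ?mul0r.
  exact: psdmx_rank1.
by split; [apply: psdmxZ; rewrite // invr_ge0 psdmx_tr_ge0|rewrite linearZ /= mulVf].
Qed.

Lemma normalizeE (A : 'M[C]_2) : psd A -> A = \tr A *: normalize A.
Proof.
rewrite /normalize => hA; case: eqP => [h|/eqP h].
  by rewrite h scale0r; apply: psdmx_tr_eq0.
by rewrite scalerA mulfV // scale1r.
Qed.

Lemma sepcone_mixture (X : 'M[C]_(2 * 2)) :
  sepcone X -> \tr X = 1 -> product_mixtures X.
Proof.
move=> /sepcone_sum_tens[n [A [B [hA hB ->]]]] trX.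
have tr_ge0 (k : 'I_n) : 0 <= \tr (A k) * \tr (B k).
  by apply: mulr_ge0; [exact: psdmx_tr_ge0 (hA k (ltn_ord k))|exact: psdmx_tr_ge0 (hB k (ltn_ord k))].
have wE (k : 'I_n) : (complex.Re (\tr (A k) * \tr (B k)))%:C = \tr (A k) * \tr (B k).
  by rewrite RRe_real // ger0_real.
exists n, (fun k => complex.Re (\tr (A k) * \tr (B k))),
  (fun k => normalize (A k)), (fun k => normalize (B k)).
split.
- by move=> k; rewrite -ler0c [X in 0 <= X]wE.
- apply: (@complexI R); rewrite rmorph_sum /= -[RHS]trX raddf_sum /=.
  by apply: eq_bigr => k _; rewrite wE tr_tens.
- by move=> k; apply/density_normalize/hA.
- by move=> k; apply/density_normalize/hB.
apply: eq_bigr => k _; rewrite wE.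
rewrite {1}(normalizeE (hA k (ltn_ord k))) {1}(normalizeE (hB k (ltn_ord k))).
by rewrite tensmxZl tensmxZr scalerA.
Qed.

End Mixtures.

(** * Pauli-diagonal maps and their symmetries *)

Section PauliMaps.
Variable R : realType.
Local Notation C := R[i].

Lemma mx2E (a b c d : C) : (mx2 a b c d 0 0 = a) * (mx2 a b c d 0 1 = b) *
  (mx2 a b c d 1 0 = c) * (mx2 a b c d 1 1 = d).
Proof. by rewrite !mxE. Qed.

Lemma sqr_iC : ('i : C)%C * 'i%C = -1.
Proof. by rewrite -expr2 sqr_i. Qed.

Lemma conj_iC : ('i%C : C)^*%R = - 'i%C.
Proof. by rewrite complexiE conjCi. Qed.

(* Lets [ring] prove identities that rely on 'i * 'i = -1. *)
Lemma eq_mod_sqr_i (x y z : C) : x = y + z * (('i : C)%C * 'i%C + 1) -> x = y.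
Proof. by rewrite sqr_iC addNr mulr0 addr0. Qed.

Definition pauli_op (l0 l1 l2 l3 : R) (X : 'M[C]_2) : 'M[C]_2 :=
  mx2 ((l0 + l3)%:C * X 0 0 + (l0 - l3)%:C * X 1 1)
      ((l1 + l2)%:C * X 0 1 + (l1 - l2)%:C * X 1 0)
      ((l1 - l2)%:C * X 0 1 + (l1 + l2)%:C * X 1 0)
      ((l0 - l3)%:C * X 0 0 + (l0 + l3)%:C * X 1 1).

Lemma pauli_op_is_linear l0 l1 l2 l3 : linear (pauli_op l0 l1 l2 l3).
Proof.
by move=> a X Y; apply: matrix2P; rewrite mxDE mxZE !mx2E !mxDE !mxZE; ring.
Qed.

HB.instance Definition _ l0 l1 l2 l3 :=
  GRing.isLinear.Build C 'M[C]_2 'M[C]_2 _ (pauli_op l0 l1 l2 l3)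
    (pauli_op_is_linear l0 l1 l2 l3).

Lemma pauli_mapE (lam : 'cV[R]_3) X :
  pauli_map lam X = 2^-1 *: pauli_op 1 (lam 0 0) (lam 1 0) (lam 2 0) X.
Proof.
have sum3 (V : nmodType) (F : 'I_3 -> V) : \sum_i F i = F 0 + F 1 + F 2.
  rewrite !big_ord_recl big_ord0 addr0 addrA.
  by congr (F _ + F _ + F _); apply/val_inj.
rewrite /pauli_map sum3 /sigma /= -[2^-1 * _]/(2^-1 * _).
rewrite /mxtrace !big_ord2 -scalerA -scalerDr; congr (_ *: _).
apply: matrix2P; rewrite !mxDE !mxZE !mulmx2E !mx2E [1%:M _ _]mxE /= -?complexiE.
- by ring.
- by apply: (@eq_mod_sqr_i _ _ ((lam 1 0)%:C * (X 1 0 - X 0 1))); ring.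
- by apply: (@eq_mod_sqr_i _ _ ((lam 1 0)%:C * (X 0 1 - X 1 0))); ring.
- by ring.
Qed.

Definition preserves_local (S : 'M[C]_(2 * 2) -> Prop) : Prop :=
  forall f g : {linear 'M[C]_2 -> 'M[C]_2}, positive_map f -> positive_map g ->
  forall X, S X -> S (tensor_map f g X).

Definition pauli_maps_to (S : 'M[C]_(2 * 2) -> Prop) (l0 l1 l2 l3 m0 m1 m2 m3 : R) :=
  forall X, psd X -> S (tensor_map (pauli_op l0 l1 l2 l3) (pauli_op m0 m1 m2 m3) X).

Section Symmetries.
Variable S : 'M[C]_(2 * 2) -> Prop.
Hypothesis S_local : preserves_local S.
Local Notation K := (pauli_maps_to S).

(** On the input a congruence is used, because its tensor product with the identity keeps psd
    matrices psd. On the output any positive [f] will do, even the transposition, since [S] is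
    stable under local positive maps. *)
Lemma pauli_maps_to_conj (f : {linear 'M[C]_2 -> 'M[C]_2}) (V : 'M[C]_2)
    l0 l1 l2 l3 k0 k1 k2 k3 m0 m1 m2 m3 :
  positive_map f -> pauli_op k0 k1 k2 k3 =1 f \o pauli_op l0 l1 l2 l3 \o conjmap V ->
  K l0 l1 l2 l3 m0 m1 m2 m3 -> K k0 k1 k2 k3 m0 m1 m2 m3.
Proof.
move=> hf E hK X hX.
have conj1 : conjmap 1%:M =1 (@idfun 'M[C]_2).
  by move=> A; rewrite /conjmap mul1mx trmx1 map_mx1 mulmx1.
rewrite (@eq_tensor_map _ _ _ _ _ _ (f \o (pauli_op l0 l1 l2 l3 \o conjmap V)) _
  (idfun \o (pauli_op m0 m1 m2 m3 \o conjmap 1%:M))) => [|A|A].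
- rewrite -tensor_map_comp; apply: S_local => //.
  by rewrite -tensor_map_comp tensor_map_conj; apply/hK/psdmx_congr.
- exact: E.
- by rewrite /= conj1.
Qed.

(** The phase gate diag(1, 'i) exchanges sigma_1 and sigma_2 up to sign; its inverse on the output
    undoes the sign. *)
Lemma pauli_maps_to_swap12 l0 l1 l2 l3 m0 m1 m2 m3 :
  K l0 l1 l2 l3 m0 m1 m2 m3 -> K l0 l2 l1 l3 m0 m1 m2 m3.
Proof.
apply: (@pauli_maps_to_conj (conjmap (mx2 1 0 0 (- 'i%C))) (mx2 1 0 0 'i%C)).
  exact: positive_conjmap.
move=> X.
apply: matrix2P; rewrite /= /conjmap !mulmx2E !mx2E !mulmx2E !adjmxE !mx2E.
all: rewrite ?conjC0 ?conjC1 ?rmorphN /= ?conj_iC.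
- by apply: (@eq_mod_sqr_i _ _ ((l0 - l3)%:C * X 1 1)); ring.
- by apply: (@eq_mod_sqr_i _ _ ((l1 + l2)%:C * X 0 1 - (l1 - l2)%:C * X 1 0)); ring.
- by apply: (@eq_mod_sqr_i _ _ ((l1 + l2)%:C * X 1 0 - (l1 - l2)%:C * X 0 1)); ring.
- apply: (@eq_mod_sqr_i _ _ ((l0 - l3)%:C * X 0 0 +
    (l0 + l3)%:C * X 1 1 * (1 - 'i%C * 'i%C))); ring.
Qed.

(** The Hadamard matrix exchanges sigma_1 and sigma_3 and negates sigma_2, twice in all. The factors
    1 on the input and 1 / 2 on the output replace its normalization 1 / sqrt 2. *)
Lemma pauli_maps_to_swap13 l0 l1 l2 l3 m0 m1 m2 m3 :
  K l0 l1 l2 l3 m0 m1 m2 m3 -> K l0 l3 l2 l1 m0 m1 m2 m3.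
Proof.
apply: (@pauli_maps_to_conj (conjmap (mx2 (1 / 2) (1 / 2) (1 / 2) (- (1 / 2)))) (mx2 1 1 1 (- 1))).
  exact: positive_conjmap.
move=> X.
apply: matrix2P; rewrite /= /conjmap !mulmx2E !mx2E !mulmx2E !adjmxE !mx2E.
all: by rewrite ?rmorphN /= ?rmorphM ?fmorphV /= ?conjC1 ?conjC_nat; field.
Qed.

(** Transposition fixes sigma_1 and sigma_3 and negates sigma_2. *)
Lemma pauli_maps_to_opp2 l0 l1 l2 l3 m0 m1 m2 m3 :
  K l0 l1 l2 l3 m0 m1 m2 m3 -> K l0 l1 (- l2) l3 m0 m1 m2 m3.
Proof.
apply: (@pauli_maps_to_conj (@trmx C 2 2) 1%:M); first exact: positive_trmx.
move=> X; rewrite /= /conjmap mul1mx trmx1 map_mx1 mulmx1.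
by apply: matrix2P; rewrite [in RHS]mxE !mx2E; ring.
Qed.

End Symmetries.

Lemma pauli_op_additive l0 l1 l2 l3 k0 k1 k2 k3 X :
  pauli_op (l0 + k0) (l1 + k1) (l2 + k2) (l3 + k3) X =
  pauli_op l0 l1 l2 l3 X + pauli_op k0 k1 k2 k3 X.
Proof. by apply: matrix2P; rewrite mxDE !mx2E; ring. Qed.

Lemma pauli_op_scale c l0 l1 l2 l3 X :
  pauli_op (c * l0) (c * l1) (c * l2) (c * l3) X = c%:C *: pauli_op l0 l1 l2 l3 X.
Proof. by apply: matrix2P; rewrite mxZE !mx2E; ring. Qed.

Lemma tensor_map_addl (f f' g h : {linear 'M[C]_2 -> 'M[C]_2}) X :
  (forall A, h A = f A + f' A) ->
  tensor_map h g X = tensor_map f g X + tensor_map f' g X.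
Proof.
move=> E; rewrite !tensor_map_block -big_split; apply: eq_bigr => i _.
by rewrite -big_split; apply: eq_bigr => j _; rewrite E tensmxDl.
Qed.

Lemma tensor_map_scalel c (f g h : {linear 'M[C]_2 -> 'M[C]_2}) X :
  (forall A, h A = c *: f A) -> tensor_map h g X = c *: tensor_map f g X.
Proof.
move=> E; rewrite !tensor_map_block scaler_sumr; apply: eq_bigr => i _.
by rewrite scaler_sumr; apply: eq_bigr => j _; rewrite E tensmxZl.
Qed.

Local Notation K := (pauli_maps_to (@sepcone C 2 2)).

Lemma pauli_sep_sym l0 l1 l2 l3 m0 m1 m2 m3 :
  K l0 l1 l2 l3 m0 m1 m2 m3 -> K m0 m1 m2 m3 l0 l1 l2 l3.
Proof.
move=> h X hX; rewrite -[X]swapmxK -tensor_map_swap.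
by apply/sepcone_swap/h/psd_swap.
Qed.

Lemma pauli_sep_add l0 l1 l2 l3 k0 k1 k2 k3 m0 m1 m2 m3 :
  K l0 l1 l2 l3 m0 m1 m2 m3 -> K k0 k1 k2 k3 m0 m1 m2 m3 ->
  K (l0 + k0) (l1 + k1) (l2 + k2) (l3 + k3) m0 m1 m2 m3.
Proof.
move=> h h' X hX; rewrite (tensor_map_addl _ _ (pauli_op_additive _ _ _ _ _ _ _ _)).
by apply: SepconeD; [apply: h|apply: h'].
Qed.

Lemma pauli_sep_scale c l0 l1 l2 l3 m0 m1 m2 m3 : 0 <= c ->
  K l0 l1 l2 l3 m0 m1 m2 m3 -> K (c * l0) (c * l1) (c * l2) (c * l3) m0 m1 m2 m3.
Proof.
move=> c0 h X hX; rewrite (tensor_map_scalel _ _ (pauli_op_scale _ _ _ _ _)).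
by apply: sepconeZ; [rewrite ler0c|apply: h].
Qed.

Lemma sepcone_local : preserves_local (@sepcone C 2 2).
Proof. by move=> f g hf hg X; apply: sepcone_tensor_map. Qed.


Lemma tensor_pauli_op l0 l1 l2 l3 (g : {linear 'M[C]_2 -> 'M[C]_2}) X :
  tensor_map (pauli_op l0 l1 l2 l3) g X =
  bmx ((l0 + l3)%:C *: g (block X 0 0) + (l0 - l3)%:C *: g (block X 1 1))
      ((l1 + l2)%:C *: g (block X 0 1) + (l1 - l2)%:C *: g (block X 1 0))
      ((l1 - l2)%:C *: g (block X 0 1) + (l1 + l2)%:C *: g (block X 1 0))
      ((l0 - l3)%:C *: g (block X 0 0) + (l0 + l3)%:C *: g (block X 1 1)).
Proof.
have pE a b c d : @delta_mx C 2 2 a b c d = ((c == a) && (d == b))%:R by rewrite mxE.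
have E00 : pauli_op l0 l1 l2 l3 (delta_mx 0 0) = mat2 (l0 + l3)%:C 0 0 (l0 - l3)%:C.
  by apply: matrix2P; rewrite mx2E mat2E !pE /=; ring.
have E01 : pauli_op l0 l1 l2 l3 (delta_mx 0 1) = mat2 0 (l1 + l2)%:C (l1 - l2)%:C 0.
  by apply: matrix2P; rewrite mx2E mat2E !pE /=; ring.
have E10 : pauli_op l0 l1 l2 l3 (delta_mx 1 0) = mat2 0 (l1 - l2)%:C (l1 + l2)%:C 0.
  by apply: matrix2P; rewrite mx2E mat2E !pE /=; ring.
have E11 : pauli_op l0 l1 l2 l3 (delta_mx 1 1) = mat2 (l0 - l3)%:C 0 0 (l0 + l3)%:C.
  by apply: matrix2P; rewrite mx2E mat2E !pE /=; ring.
by rewrite tensor_map_block 3!big_ord2 /= E00 E01 E10 E11 sum_tens_mat2.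
Qed.

(** [a0] and [a1] are the halves of an input vector, so the blocks of the input are the matrices
    outer aj ak. *)
Lemma pauli_sep_rank1 l0 l1 l2 l3 m0 m1 m2 m3 :
  let g := pauli_op m0 m1 m2 m3 in
  (forall a0 a1 : 'cV[C]_2, sepcone
    (bmx ((l0 + l3)%:C *: g (outer a0 a0) + (l0 - l3)%:C *: g (outer a1 a1))
         ((l1 + l2)%:C *: g (outer a0 a1) + (l1 - l2)%:C *: g (outer a1 a0))
         ((l1 - l2)%:C *: g (outer a0 a1) + (l1 + l2)%:C *: g (outer a1 a0))
         ((l0 - l3)%:C *: g (outer a0 a0) + (l0 + l3)%:C *: g (outer a1 a1)))) ->
  K l0 l1 l2 l3 m0 m1 m2 m3.
Proof.
move=> g h X /psdmx_sum_rank1[v ->]; rewrite linear_sum; apply: sepcone_sum => i _.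
rewrite /= tensor_pauli_op.
have E j k : block (v i *m (v i)^t*) j k =
    outer (\col_a v i (mxtens_index (j, a)) 0) (\col_a v i (mxtens_index (k, a)) 0).
  by apply/matrixP=> a b; rewrite outerE !mxE big_ord1 !mxE.
by rewrite !E; apply: h.
Qed.

Lemma bmx_diag_separable (A D : 'M[C]_2) : psd A -> psd D -> sepcone (bmx A 0 0 D).
Proof.
move=> hA hD; rewrite /bmx !tensmx0 !addr0.
exact: (SepconeD (SepconeT (psdmx_delta 0) hA) (SepconeT (psdmx_delta 1) hD)).
Qed.

(** With its axis moved to sigma_3, (1; 0, 0, 1) keeps only the diagonal blocks, while (1; 1, 1, 1)
    is twice the identity. *)
Lemma pauli_sep_111_100 : K 1 1 1 1 1 1 0 0.
Proof.
apply: pauli_sep_sym; apply: (pauli_maps_to_swap13 sepcone_local).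
apply: pauli_sep_rank1 => a0 a1.
have gE X : psd X -> psd (pauli_op 1 1 1 1 X : 'M[C]_2).
  move=> hX; have -> : pauli_op 1 1 1 1 X = 2 *: X.
    by apply: matrix2P; rewrite mxZE !mx2E; ring.
  by apply: psdmxZ.
have hG a : psd (2 *: pauli_op 1 1 1 1 (outer a a) : 'M[C]_2).
  by apply/psdmxZ/gE/psdmx_rank1.
have E (X1 X2 X3 X4 : 'M[C]_2) : bmx ((1 + 1)%:C *: X1 + (1 - 1)%:C *: X4)
    ((0 + 0)%:C *: X2 + (0 - 0)%:C *: X3) ((0 - 0)%:C *: X2 + (0 + 0)%:C *: X3)
    ((1 - 1)%:C *: X1 + (1 + 1)%:C *: X4) = bmx (2 *: X1) 0 0 (2 *: X4) :> 'M[C]_(2 * 2).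
  rewrite (addr0 (0 : R)) (subrr (0 : R)) (subrr (1 : R)) !scale0r !addr0 add0r.
  by rewrite -(natrD _ 1 1) rmorph_nat.
by rewrite E; apply: bmx_diag_separable; apply: hG.
Qed.

End PauliMaps.

(** * The remaining three families as Pauli-diagonal maps *)

Section BaseFamilies.
Variable R : realType.
Local Notation C := R[i].
Local Notation K := (pauli_maps_to (@sepcone C 2 2)).

Definition cabs (z : C) : R := complex.Re `|z|.

Lemma real_complex_ge0 x : (0 <= real_complex R x) = (0 <= x).
Proof. exact: ler0c. Qed.

Lemma cabsE z : real_complex R (cabs z) = `|z|.
Proof. exact: RRe_real (normr_real z). Qed.

Lemma complexr2 : (1 + 1)%:C = 2 :> C.
Proof. by rewrite rmorphD rmorph1. Qed.

Lemma pauli_op_iso y (a b : 'cV[C]_2) :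
  pauli_op (1 + y) 1 1 1 (outer a b) = isoop (real_complex R) y a b.
Proof.
rewrite /isoop; apply: matrix2P; rewrite !mx2E mxDE mxZE !outerE [X in _ = _ + X]mxE /dot /=; ring.
Qed.

Lemma pauli_op_damp y (a b : 'cV[C]_2) : pauli_op 1 y y 1 (outer a b) = damp (y%:C) a b.
Proof.
apply: matrix2P; rewrite mx2E mat2E; move: (outer a b) => X; rewrite ?subrr; ring.
Qed.

(** The axes of l are reordered as (y, 0, 1): l2 = 0 equates the off-diagonal blocks and l0 = l3
    leaves one term in each diagonal block. *)
Lemma pauli_sep_1y0_111 y : 0 <= y <= 1 -> K 1 1 y 0 (1 + y) 1 1 1.
Proof.
move=> y01; apply: (pauli_maps_to_swap13 (@sepcone_local R)).
apply: (pauli_maps_to_swap12 (@sepcone_local R)); apply: pauli_sep_rank1 => a0 a1.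
rewrite !pauli_op_iso complexr2 addr0 subr0 subrr.
have := iso_separable real_complex_ge0 cabsE a0 a1 y01.
move: (isoop _ _ a0 a0) (isoop _ _ a0 a1) (isoop _ _ a1 a0) (isoop _ _ a1 a1).
by move=> X1 X2 X3 X4; rewrite !scale0r addr0 add0r -!scalerDr.
Qed.

Lemma pauli_sep_11y_111 y : 0 <= y <= 1 -> K 1 1 1 y (2 + y) 1 1 1.
Proof.
move=> y01; rewrite (natrD _ 1 1) -addrA; apply: pauli_sep_rank1 => a0 a1.
rewrite !pauli_op_iso complexr2 subrr.
have := depolarized_separable real_complex_ge0 cabsE a0 a1 y01.
move: (isoop _ _ a0 a0) (isoop _ _ a0 a1) (isoop _ _ a1 a0) (isoop _ _ a1 a1).
by move=> X1 X2 X3 X4; rewrite !scale0r addr0 add0r.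
Qed.

(** The factors are exchanged and (1, 1, 0) is reordered as (1, 0, 1) to equate the off-diagonal
    blocks; the other factor becomes the phase damping (1; y, y, 1). *)
Lemma pauli_sep_1yy_110 y : 0 <= y <= 1 -> K 1 1 y y (1 + y) 1 1 0.
Proof.
move=> y01; apply: (pauli_maps_to_swap13 (@sepcone_local R)); apply: pauli_sep_sym.
apply: (pauli_maps_to_swap12 (@sepcone_local R)).
apply: (pauli_maps_to_swap13 (@sepcone_local R)).
apply: (pauli_maps_to_swap12 (@sepcone_local R)); apply: pauli_sep_rank1 => a0 a1.
have y01' : 0 <= y%:C <= (1 : C) by rewrite ler0c lecR.
have y2 : (1 + y + 1)%:C = 2 + y%:C :> C by rewrite addrAC -complexr2 -rmorphD.
rewrite !pauli_op_damp y2 addr0 subr0 (addrAC 1 y) subrr add0r.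
have := damp_separable a0 a1 y01'.
move: (damp _ a0 a0) (damp _ a0 a1) (damp _ a1 a0) (damp _ a1 a1).
by move=> X1 X2 X3 X4; rewrite !scale1r.
Qed.

End BaseFamilies.

(** * Signed permutation matrices and sums of absolute values *)

Section SignedPermutations.
Variable R : realType.

Lemma signed_perm_mx_of n (f : 'I_n -> 'I_n) (e : 'I_n -> R) : injective f ->
  (forall i, e i = 1 \/ e i = - 1) ->
  signed_perm_mx (\matrix_(i, j) (e i * (j == f i)%:R)).
Proof.
move=> finj he; have ne i : e i != 0.
  by case: (he i) => ->; rewrite ?oppr_eq0 oner_eq0.
have nE i j : (\matrix_(i, j) (e i * (j == f i)%:R)) i j != 0 -> j = f i.
  by rewrite mxE; have [-> //|_] := eqVneq j (f i); rewrite mulr0 eqxx.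
have nf i : (\matrix_(i, j) (e i * (j == f i)%:R)) i (f i) != 0.
  by rewrite mxE eqxx mulr1.
split=> [i|j|i j].
- by exists (f i); split=> // j /nE.
- exists (invF finj j); split=> [|i /nE ->]; last exact: invF_f.
  by have := nf (invF finj j); rewrite f_invF.
- by move/nE => ->; rewrite mxE eqxx mulr1.
Qed.

Lemma signed_perm_mx_form n (P : 'M[R]_n) : signed_perm_mx P ->
  exists2 f : 'I_n -> 'I_n, injective f & exists2 e : 'I_n -> R, (forall i, `|e i| = 1) &
    forall l m : 'cV[R]_n, (l^T *m P *m m) 0 0 = \sum_i e i * l i 0 * m (f i) 0.
Proof.
move=> [hr hc hs]; have [f hf] := boolp.choice hr.
exists f => [i j fij|].
  have [k [_ hk]] := hc (f i); rewrite -(hk i); last exact: (hf i).1.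
  by apply: hk; rewrite fij; exact: (hf j).1.
exists (fun i => P i (f i)) => [i|l m].
  by case: (hs _ _ (hf i).1) => ->; rewrite ?normrN normr1.
rewrite -mulmxA mxE; apply: eq_bigr => i _; rewrite !mxE (bigD1 (f i)) //=.
rewrite big1 ?addr0; first by rewrite mulrA [l i 0 * _]mulrC.
move=> j nj; have [->|/eqP h] := P i j =P 0; first by rewrite mul0r.
by rewrite ((hf i).2 j h) eqxx in nj.
Qed.

(** The signs of P are free, and the best choice turns every product into its absolute value. *)
Lemma signed_perm_bound n (l m : 'cV[R]_n) :
  (forall P, signed_perm_mx P -> (l^T *m P *m m) 0 0 <= 1) <->
  (forall f : 'I_n -> 'I_n, injective f -> \sum_i `|l i 0| * `|m (f i) 0| <= 1).
Proof.
split=> [h f finj|h P /signed_perm_mx_form[f finj [e he ->]]].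
  pose e i : R := if 0 <= l i 0 * m (f i) 0 then 1 else - 1.
  have he i : e i = 1 \/ e i = - 1 by rewrite /e; case: ifP; [left|right].
  apply: le_trans (h _ (signed_perm_mx_of finj he)); rewrite le_eqVlt; apply/orP; left.
  apply/eqP; rewrite -mulmxA mxE; apply: eq_bigr => i _; rewrite !mxE (bigD1 (f i)) //=.
  rewrite big1 ?addr0 => [|j nj]; last by rewrite mxE (negPf nj) mulr0 mul0r.
  rewrite mxE eqxx mulr1 -normrM /e; case: ifP => [s|/negbT s].
    by rewrite ger0_norm // mul1r.
  by rewrite ltr0_norm ?real_ltNge ?num_real // mulN1r mulrN.
apply: le_trans (h f finj); apply: ler_sum => i _.
by rewrite (le_trans (ler_norm _)) // !normrM he mul1r.
Qed.

Lemma ord3P (P : 'I_3 -> Prop) : P 0 -> P 1 -> P 2 -> forall i, P i.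
Proof.
move=> P0 P1 P2 [[|[|[|//]]] h]; first by rewrite (_ : Ordinal h = 0) //; apply/val_inj.
  by rewrite (_ : Ordinal h = 1) //; apply/val_inj.
by rewrite (_ : Ordinal h = 2) //; apply/val_inj.
Qed.

Lemma big_ord3 (V : nmodType) (F : 'I_3 -> V) : \sum_i F i = F 0 + F 1 + F 2.
Proof.
rewrite !big_ord_recl big_ord0 addr0 addrA.
by congr (F _ + F _ + F _); apply/val_inj.
Qed.

Lemma perm_boundsP (l m : 'cV[R]_3) :
  perm_bounds (l 0 0) (l 1 0) (l 2 0) (m 0 0) (m 1 0) (m 2 0) <->
  forall P, signed_perm_mx P -> (l^T *m P *m m) 0 0 <= 1.
Proof.
rewrite signed_perm_bound; split=> [[[h1 h2 h3] [h4 h5 h6]] f finj|h].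
  have n01 : f 0 <> f 1 by move/finj.
  have n02 : f 0 <> f 2 by move/finj.
  have n12 : f 1 <> f 2 by move/finj.
  rewrite big_ord3; move: (f 0) (f 1) (f 2) n01 n02 n12.
  by do 3![apply: ord3P].
have inst (a b c : 'I_3) : a != b -> a != c -> b != c ->
    `|l 0 0| * `|m a 0| + `|l 1 0| * `|m b 0| + `|l 2 0| * `|m c 0| <= 1.
  move=> nab nac nbc; pose f (i : 'I_3) := if i == 0 then a else if i == 1 then b else c.
  have := h f; rewrite big_ord3 /f /=; apply.
  move: nab nac nbc => /eqP nab /eqP nac /eqP nbc.
  apply: ord3P; apply: ord3P => //= E; first [by case: (nab E)|by case: (nac E)|by case: (nbc E)|
    by case: (nab (esym E))|by case: (nac (esym E))|by case: (nbc (esym E))].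
by split; split; apply: inst.
Qed.

End SignedPermutations.

(** * Closure of the mixtures by duality *)

Section Necessity.
Variable R : realType.
Local Notation C := R[i].

(* Membership in the closed cone generated by products, expressed by duality. *)
Definition dual_nonneg (X : 'M[C]_(2 * 2)) : Prop :=
  forall phi : {scalar 'M[C]_(2 * 2)},
    (forall A B : 'M[C]_2, psd A -> psd B -> 0 <= phi (tensmx A B)) -> 0 <= phi X.

Lemma dual_nonneg_local : preserves_local dual_nonneg.
Proof.
move=> f g hf hg X hX phi hphi; apply: (hX (phi \o tensor_map f g)) => A B hA hB /=.
by rewrite tensor_map_tens; apply: hphi; [apply: hf|apply: hg].
Qed.

Lemma sepcone_dual_nonneg X : sepcone X -> dual_nonneg X.
Proof.
move=> hX phi hphi; elim: hX => [|A B hA hB|Y Z _ hY _ hZ].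
- by rewrite linear0.
- by apply: hphi; apply/psdE.
- by rewrite linearD; exact: addr_ge0.
Qed.

Lemma dual_nonnegZ c X : 0 <= c -> dual_nonneg X -> dual_nonneg (c *: X).
Proof. by move=> c0 hX phi hphi; rewrite linearZ mulr_ge0 // hX. Qed.

Lemma product_mixtures_dual_nonneg X : product_mixtures X -> dual_nonneg X.
Proof.
move=> [n [p [A [B [p0 _ hA hB ->]]]]] phi hphi; rewrite linear_sum sumr_ge0 // => k _.
by rewrite linearZ mulr_ge0 ?ler0c ?p0 //; apply: hphi; [case: (hA k)|case: (hB k)].
Qed.

(** As y = |y|, the distance from z to |z| is at most twice that from z to y, hence arbitrarily
    small, and z = |z|. *)
Lemma ge0_of_dist (z : C) M : 0 <= M ->
  (forall e : R, 0 < e -> exists2 y, 0 <= y & `|y - z| <= M * e%:C) -> 0 <= z.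
Proof.
move=> M0 h; suff -> : z = `|z| by [].
apply/eqP; rewrite eq_sym -subr_eq0 -normr_eq0 eq_le normr_ge0 andbT.
have M1 : 0 < 1 + cabs M by rewrite ltr_wpDr // -real_complex_ge0 cabsE.
have bound (e : R) : 0 < e -> `|(`|z| - z)| <= 2 * (M * e%:C).
  move=> e0; have [y y0 hy] := h e e0.
  have -> : `|z| - z = (`|z| - `|y|) + (y - z) by rewrite (ger0_norm y0); ring.
  apply: (le_trans (ler_normD _ _)); rewrite mulrDl mul1r lerD //.
  by rewrite (le_trans (ler_dist_dist _ _)) // distrC.
rewrite -cabsE lecR; apply/ler_addgt0Pl => e e0; rewrite addr0.
pose c := cabs M; have c0 : 0 <= c by rewrite -real_complex_ge0 cabsE.
pose x := e / (2 * (1 + c)).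
have x0 : 0 < x by rewrite divr_gt0 // mulr_gt0.
have hx : 2 * (c * x) <= e.
  have xE : x * (2 * (1 + c)) = e by rewrite divfK // gt_eqF // mulr_gt0.
  by rewrite -xE; have := ltW x0; nra.
have := bound x x0; have -> : 2 * (M * x%:C) = (2 * (c * x))%:C.
  by rewrite !rmorphM /= cabsE (ger0_norm M0) rmorph_nat.
by rewrite -cabsE lecR => /le_trans; apply.
Qed.

(** [phi] is Lipschitz for the entrywise norm, with constant the sum of its moduli on the matrix
    units. *)
Lemma closure_dual_nonneg (X : 'M[C]_(2 * 2)) : closure (@product_mixtures R) X -> dual_nonneg X.
Proof.
move=> hX phi hphi.
have phiE (Y : 'M[C]_(2 * 2)) : phi Y = \sum_i \sum_j Y i j * phi (delta_mx i j).
  rewrite [in LHS](matrix_sum_delta Y) linear_sum; apply: eq_bigr => i _.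
  by rewrite linear_sum; apply: eq_bigr => j _; rewrite linearZ.
apply: (@ge0_of_dist _ (\sum_i \sum_j `|phi (delta_mx i j)|)).
  by rewrite sumr_ge0 // => i _; rewrite sumr_ge0.
move=> e e0; have e0' : 0 < e%:C :> C by rewrite ltcR.
have [Y [/product_mixtures_dual_nonneg hY [_ XY]]] := hX _ (nbhsx_ballx X e%:C e0').
exists (phi Y); first exact: hY.
rewrite -linearB phiE mulr_suml; apply: (le_trans (ler_norm_sum _ _ _)).
apply: ler_sum => i _; rewrite mulr_suml; apply: (le_trans (ler_norm_sum _ _ _)).
apply: ler_sum => j _; rewrite normrM mulrC ler_wpM2l //.
have := XY i j; rewrite /ball /= => h; apply: ltW.
by rewrite mxE [(- X) _ _]mxE distrC.
Qed.

End Necessity.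

(** * The entanglement witness and the permutation inequalities *)

Section Witness.
Variable R : realType.
Local Notation C := R[i].

(* The witness tr(Y) - <v, Y v>, where v is the unnormalized maximally entangled vector. *)
Definition witness (Y : 'M[C]_(2 * 2)) : C :=
  Y (mxtens_index (0, 1)) (mxtens_index (0, 1)) +
  Y (mxtens_index (1, 0)) (mxtens_index (1, 0)) -
  Y (mxtens_index (0, 0)) (mxtens_index (1, 1)) -
  Y (mxtens_index (1, 1)) (mxtens_index (0, 0)).

Lemma witness_is_scalar : scalar witness.
Proof. by move=> a X Y; rewrite /witness !mxDE !mxZE; ring. Qed.

HB.instance Definition _ :=
  GRing.isLinear.Build C 'M[C]_(2 * 2) C _ witness witness_is_scalar.

Lemma witness_tens (A B : 'M[C]_2) : witness (tensmx A B) =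
  A 0 0 * B 1 1 + A 1 1 * B 0 0 - A 0 1 * B 0 1 - A 1 0 * B 1 0.
Proof. by rewrite /witness !tensmxE. Qed.

(** On a product of rank-one matrices the witness is the squared modulus of a0 conj(b1) - a1
    conj(b0). *)
Lemma witness_ge0 (A B : 'M[C]_2) : psd A -> psd B -> 0 <= witness (tensmx A B).
Proof.
move=> /psdE/psdmx_sum_rank1[a ->] /psdE/psdmx_sum_rank1[b ->].
rewrite tensmx_suml linear_sum sumr_ge0 // => i _.
rewrite tensmx_sumr linear_sum sumr_ge0 // => j _.
rewrite /= witness_tens -!/(outer _ _) !outerE.
move: (a i 0 0) (a i 1 0) (b j 0 0) (b j 1 0) => a0 a1 b0 b1.
have := mul_conjC_ge0 (a0 * b1^*%R - a1 * b0^*%R).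
congr (0 <= _); rewrite !(rmorphB Num.conj, rmorphM Num.conj) /= !conjCK; ring.
Qed.

Definition max_entangled : 'M[C]_(2 * 2) :=
  bmx (delta_mx 0 0) (delta_mx 0 1) (delta_mx 1 0) (delta_mx 1 1).

Lemma psd_max_entangled : psd max_entangled.
Proof.
apply/psdE/psdmx_bmxP => b0 b1; rewrite !form2E ![delta_mx _ _ _ _]mxE /=.
have := mul_conjC_ge0 ((b0 0 0 + b1 1 0)^*%R).
by rewrite conjCK (rmorphD Num.conj) /=; congr (0 <= _); ring.
Qed.

Lemma witness_pauli l0 l1 l2 l3 m0 m1 m2 m3 :
  witness (tensor_map (pauli_op l0 l1 l2 l3) (pauli_op m0 m1 m2 m3) max_entangled) =
  (4 * (l0 * m0 - (l1 * m1 + l2 * m2 + l3 * m3)))%:C.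
Proof.
have [e00 e01 e10 e11] := @bmx_block C (delta_mx 0 0) (delta_mx 0 1) (delta_mx 1 0) (delta_mx 1 1).
rewrite tensor_map_block 3!big_ord2 e00 e01 e10 e11 !linearD /= !witness_tens.
have pE a b c d : @delta_mx C 2 2 a b c d = ((c == a) && (d == b))%:R by rewrite mxE.
rewrite !mx2E !pE /=; ring.
Qed.

Local Notation K := (pauli_maps_to (@dual_nonneg R)).

Lemma dual_nonneg_pauli l1 l2 l3 m1 m2 m3 : K 1 l1 l2 l3 1 m1 m2 m3 ->
  l1 * m1 + l2 * m2 + l3 * m3 <= 1.
Proof.
move/(_ _ psd_max_entangled)/(_ witness witness_ge0); rewrite /= witness_pauli ler0c.
by rewrite mulr1 pmulr_rge0 // subr_ge0.
Qed.

(** Flipping signs of l turns each product in the witness inequality into its absolute value; the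
    six permutations are words in the transpositions (1 2) and (1 3). *)
Lemma dual_nonneg_perm_bounds l1 l2 l3 m1 m2 m3 : K 1 l1 l2 l3 1 m1 m2 m3 ->
  perm_bounds l1 l2 l3 m1 m2 m3.
Proof.
have N1 k1 k2 k3 : K 1 k1 k2 k3 1 m1 m2 m3 -> K 1 (- k1) k2 k3 1 m1 m2 m3.
  move=> h; apply: (pauli_maps_to_swap12 (@dual_nonneg_local R)).
  apply: (pauli_maps_to_opp2 (@dual_nonneg_local R)).
  exact: (pauli_maps_to_swap12 (@dual_nonneg_local R)).
have N2 k1 k2 k3 : K 1 k1 k2 k3 1 m1 m2 m3 -> K 1 k1 (- k2) k3 1 m1 m2 m3.
  exact: (pauli_maps_to_opp2 (@dual_nonneg_local R)).
have N3 k1 k2 k3 : K 1 k1 k2 k3 1 m1 m2 m3 -> K 1 k1 k2 (- k3) 1 m1 m2 m3.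
  move=> h; apply: (pauli_maps_to_swap13 (@dual_nonneg_local R)); apply: N1.
  exact: (pauli_maps_to_swap13 (@dual_nonneg_local R)).
have sgn k m (P : R -> Prop) : (P k -> P (- k)) -> P k ->
    exists2 k', P k' & `|k| * `|m| = k' * m.
  move=> hN hk; rewrite -normrM; have [s|s] := leP 0 (k * m).
    by exists k => //; rewrite ger0_norm.
  by exists (- k); [exact: hN|rewrite ltr0_norm // mulNr].
have bound k1 k2 k3 : K 1 k1 k2 k3 1 m1 m2 m3 ->
    `|k1| * `|m1| + `|k2| * `|m2| + `|k3| * `|m3| <= 1.
  move=> h.
  have [k1' /= h1 ->] := sgn k1 m1 (fun k => K 1 k k2 k3 1 m1 m2 m3) (N1 _ _ _) h.
  have [k2' /= h2 ->] := sgn k2 m2 (fun k => K 1 k1' k k3 1 m1 m2 m3) (N2 _ _ _) h1.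
  have [k3' /= h3 ->] := sgn k3 m3 (fun k => K 1 k1' k2' k 1 m1 m2 m3) (N3 _ _ _) h2.
  exact: dual_nonneg_pauli.
move=> h; have h12 k1 k2 k3 := @pauli_maps_to_swap12 _ _ (@dual_nonneg_local R) 1 k1 k2 k3 1 m1 m2 m3.
have h13 k1 k2 k3 := @pauli_maps_to_swap13 _ _ (@dual_nonneg_local R) 1 k1 k2 k3 1 m1 m2 m3.
have := bound _ _ _ h; have := bound _ _ _ (h12 _ _ _ h); have := bound _ _ _ (h13 _ _ _ h).
have := bound _ _ _ (h12 _ _ _ (h13 _ _ _ h)); have := bound _ _ _ (h13 _ _ _ (h12 _ _ _ h)).
have := bound _ _ _ (h12 _ _ _ (h13 _ _ _ (h12 _ _ _ h))).
by move=> *; split; split; lra.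
Qed.

End Witness.

(** * The normalized maps and the equivalence *)

Section PauliChannels.
Variable R : realType.
Local Notation C := R[i].

Lemma pauli_op_111 (X : 'M[C]_2) : pauli_op 1 1 1 1 X = 2 *: X.
Proof. by apply: matrix2P; rewrite mxZE !mx2E; ring. Qed.

Lemma pauli_map_op (lam : 'cV[R]_3) (X : 'M[C]_2) :
  pauli_op 1 (lam 0 0) (lam 1 0) (lam 2 0) X = pauli_map lam (pauli_op 1 1 1 1 X).
Proof.
by rewrite pauli_op_111 linearZ /= pauli_mapE scalerA divff ?scale1r // pnatr_eq0.
Qed.

Lemma tensor_pauli_map (lam lam' : 'cV[R]_3) X :
  tensor_map (pauli_map lam) (pauli_map lam') X = (2^-1 * 2^-1) *:
    tensor_map (pauli_op 1 (lam 0 0) (lam 1 0) (lam 2 0))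
               (pauli_op 1 (lam' 0 0) (lam' 1 0) (lam' 2 0)) X.
Proof.
rewrite !tensor_map_block scaler_sumr; apply: eq_bigr => i _.
rewrite scaler_sumr; apply: eq_bigr => j _.
by rewrite /= !pauli_mapE tensmxZl tensmxZr scalerA.
Qed.

Lemma tr_pauli_map (lam : 'cV[R]_3) X : \tr (pauli_map lam X) = \tr X.
Proof.
by rewrite pauli_mapE linearZ /= /mxtrace !big_ord2 !mx2E; field.
Qed.

Lemma tr_tensor_map (f g : {linear 'M[C]_2 -> 'M[C]_2}) X :
  (forall A, \tr (f A) = \tr A) -> (forall A, \tr (g A) = \tr A) ->
  \tr (tensor_map f g X) = \tr X.
Proof.
move=> hf hg; rewrite tensor_map_block [in RHS](matrix_sum_block X) !raddf_sum.
apply: eq_bigr => i _; rewrite !raddf_sum; apply: eq_bigr => j _.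
by rewrite /= !tr_tens hf hg.
Qed.

(* Tested against the measure-and-prepare map (1; 1, 0, 0), which breaks entanglement. *)
Lemma positive_pauli_bound (lam : 'cV[R]_3) : positive_map (pauli_map lam) ->
  forall i, `|lam i 0| <= 1.
Proof.
move=> pos; suff : perm_bounds (lam 0 0) (lam 1 0) (lam 2 0) 1 0 0.
  by rewrite /perm_bounds normr0 normr1 => -[[h1 h2 h3] [h4 h5 h6]]; apply: ord3P; lra.
apply: dual_nonneg_perm_bounds => X hX; apply: sepcone_dual_nonneg.
(* The map (1; lam) is [pauli_map lam] after (1; 1, 1, 1), so the output is the image of a separable
   matrix under a local positive map. *)
rewrite (@eq_tensor_map _ _ _ _ _ _ (pauli_map lam \o pauli_op 1 1 1 1) _
  (idfun \o pauli_op 1 1 0 0)) => [|A|A] //; last exact: pauli_map_op.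
rewrite -tensor_map_comp; apply: sepcone_local => //.
exact: pauli_sep_111_100.
Qed.

Lemma separable_perm_bounds (lam lam' : 'cV[R]_3) :
  entanglement_annihilating (tensor_map (pauli_map lam) (pauli_map lam')) ->
  perm_bounds (lam 0 0) (lam 1 0) (lam 2 0) (lam' 0 0) (lam' 1 0) (lam' 2 0).
Proof.
move=> EA; apply: dual_nonneg_perm_bounds => X hX.
(* A psd input of trace 0 vanishes; any other is scaled to a density, and the scaling is undone at
   the end. *)
have [/(psdmx_tr_eq0 hX) ->|t0] := eqVneq (\tr X) 0.
  by move=> phi _; rewrite !linear0.
have tge : 0 <= \tr X := psdmx_tr_ge0 hX.
have [|_ /closure_dual_nonneg] := EA ((\tr X)^-1 *: X).
  by split; [apply: psdmxZ; rewrite ?invr_ge0|rewrite linearZ /= mulVf].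
rewrite /= tensor_pauli_map linearZ scalerA => h.
have c0 : 2^-1 * 2^-1 * (\tr X)^-1 != 0 :> C.
  by rewrite !mulf_neq0 ?invr_eq0 ?pnatr_eq0.
have := dual_nonnegZ (_ : 0 <= (2^-1 * 2^-1 * (\tr X)^-1)^-1) h.
rewrite scalerA mulVf // scale1r; apply.
by rewrite invr_ge0 !mulr_ge0 ?invr_ge0.
Qed.

Lemma perm_bounds_sepcone (lam lam' : 'cV[R]_3) :
  (forall i, `|lam i 0| <= 1) -> (forall i, `|lam' i 0| <= 1) ->
  perm_bounds (lam 0 0) (lam 1 0) (lam 2 0) (lam' 0 0) (lam' 1 0) (lam' 2 0) ->
  forall X, psd X -> sepcone (tensor_map (pauli_map lam) (pauli_map lam') X).
Proof.
move=> h h' hb X hX; rewrite tensor_pauli_map.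
apply: sepconeZ; first by rewrite mulr_ge0 ?invr_ge0.
apply: (pauli_cone (K := pauli_maps_to (@sepcone C 2 2))).
- exact: pauli_sep_sym.
- exact: pauli_sep_add.
- exact: pauli_sep_scale.
- exact: (pauli_maps_to_swap12 (@sepcone_local R)).
- exact: (pauli_maps_to_swap13 (@sepcone_local R)).
- exact: (pauli_maps_to_opp2 (@sepcone_local R)).
- exact: pauli_sep_111_100.
- exact: pauli_sep_1y0_111.
- exact: pauli_sep_1yy_110.
- exact: pauli_sep_11y_111.
- by split.
- by split.
- exact: hb.
exact: hX.
Qed.

End PauliChannels.

Theorem proposition1 (R : realType) (lam lam' : 'cV[R]_3)
    (posU : positive_map (pauli_map lam)) (posU' : positive_map (pauli_map lam')) :
  positive_map (tensor_map (pauli_map lam) (pauli_map lam')) /\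
  entanglement_annihilating (tensor_map (pauli_map lam) (pauli_map lam'))
  <->
  [/\ forall i : 'I_3, `|lam i 0| <= 1,
      forall i : 'I_3, `|lam' i 0| <= 1
    & forall P : 'M[R]_3, signed_perm_mx P ->
        (lam^T *m P *m lam') 0 0 <= 1].
Proof.
split=> [[_ /separable_perm_bounds/perm_boundsP hb]|[h h' /perm_boundsP hb]].
  by split; [exact: positive_pauli_bound|exact: positive_pauli_bound|].
have sep := perm_bounds_sepcone h h' hb; split=> [X /sep/sepcone_psd //|rho [hrho tr1]].
have tr1' : \tr (tensor_map (pauli_map lam) (pauli_map lam') rho) = 1.
  by rewrite tr_tensor_map //; apply: tr_pauli_map.
split; first by split=> //; exact: (sepcone_psd (sep _ hrho)).
by apply: subset_closure; apply: sepcone_mixture => //; exact: sep.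
Qed.
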